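(* Consider a Hadamard model $\mathcal S\subset\mathbb Z^2$ with step polynomial $S(x,y)=U(x)+V(x)T(y)$, and let $\mathcal U,\mathcal V,\mathcal T$ be the (finite) subsets of $\mathbb Z$ with generating polynomials $U(x)$, $V(x)$ and $T(y)$ respectively. Let $C_1(x,v;t)$ be the generating function of walks on $\mathbb N$, starting from $0$ and taking steps in the multiset $\mathcal U\cup\mathcal V$ (steps in $\mathcal U\cap\mathcal V$ occur twice), counted by the length (variable $t$), the position of the endpoint ($x$), and the number of steps in $\mathcal V$ ($v$). Let $C_2(y;v)$ be the generating function of walks on $\mathbb N$, starting from $0$ and taking steps in $\mathcal T$, counted by the length ($v$) and the endpoint ($y$). Then $C_1(x,v;t)$ and $C_2(y;v)$ are algebraic, and the generating function of quadrant walks with steps in $\mathcal S$ is $$Q(x,y;t)=\left.C_1(x,v;t)\odot_vC_2(y;v)\right|_{v=1},$$ where $\odot_v$ denotes the Hadamard product in $v$, defined by $\sum a_nv^n\odot_v\sum b_nv^n=\sum a_nb_nv^n$. In particular, $Q(x,y;t)$ is D-finite.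
   Context: $\mathbb N=\{0,1,2,\ldots\}$. The step polynomial of a finite set $\mathcal S\subset\mathbb Z^2$ is $S(x,y)=\sum_{(k,\ell)\in\mathcal S}x^ky^\ell$; the model is Hadamard if $S(x,y)=U(x)+V(x)T(y)$ for some Laurent polynomials $U,V,T$. The generating polynomial of a finite set $\mathcal U\subset\mathbb Z$ is $\sum_{i\in\mathcal U}x^i$. $Q(x,y;t)=\sum_{i,j,n\ge0}q(i,j;n)x^iy^jt^n$, where $q(i,j;n)$ counts $n$-step walks with steps in $\mathcal S$ from $(0,0)$ to $(i,j)$ staying in $\mathbb N^2$. A series is algebraic if it is a root of a non-zero polynomial with coefficients that are polynomials over $\mathbb Q$ in its variables. $Q(x,y;t)$ is D-finite (with respect to $t$) if the $\mathbb Q(x,y,t)$-vector space spanned by its iterated derivatives $\partial_t^mQ$, $m\ge0$, has finite dimension. *)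

(* Defs.v *)
From HB Require Import structures.
From mathcomp Require Import all_boot all_order all_algebra finmap.
From mathcomp Require Import boolp.

Set Implicit Arguments.
Unset Strict Implicit.
Unset Printing Implicit Defensive.

Import Order.TTheory GRing.Theory Num.Theory.

Local Open Scope ring_scope.

Reserved Notation "{ 'fps' R }" (format "{ 'fps'  R }").

(** * Formal power series in one variable *)

Record fps (R : Type) := Fps { coefs : nat -> R }.
Notation "{ 'fps' R }" := (fps R) : type_scope.

Lemma fpsP (R : Type) (F G : {fps R}) :
  (forall n, coefs F n = coefs G n) <-> F = G.
Proof.
split=> [eqFG|-> //]; case: F G eqFG => [f] [g] /= eqfg.
by congr Fps; apply: funext.
Qed.

(* Power series have no decidable equality; these two instances are classical. *)
HB.instance Definition _ (R : Type) := gen_eqMixin {fps R}.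
HB.instance Definition _ (R : Type) := gen_choiceMixin {fps R}.

Section FpsZmodule.
Variable R : zmodType.
Implicit Types F G H : {fps R}.

Definition fps_zero : {fps R} := Fps (fun=> 0).
Definition fps_opp F : {fps R} := Fps (fun n => - coefs F n).
Definition fps_add F G : {fps R} := Fps (fun n => coefs F n + coefs G n).

Fact fps_addA : associative fps_add.
Proof. by move=> F G H; apply/fpsP => n /=; rewrite addrA. Qed.
Fact fps_addC : commutative fps_add.
Proof. by move=> F G; apply/fpsP => n /=; rewrite addrC. Qed.
Fact fps_add0 : left_id fps_zero fps_add.
Proof. by move=> F; apply/fpsP => n /=; rewrite add0r. Qed.
Fact fps_addN : left_inverse fps_zero fps_opp fps_add.
Proof. by move=> F; apply/fpsP => n /=; rewrite addNr. Qed.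

HB.instance Definition _ :=
  GRing.isZmodule.Build {fps R} fps_addA fps_addC fps_add0 fps_addN.

Lemma coefs0 n : coefs (0 : {fps R}) n = 0. Proof. by []. Qed.
Lemma coefsD F G n : coefs (F + G) n = coefs F n + coefs G n.
Proof. by []. Qed.
Lemma coefsN F n : coefs (- F) n = - coefs F n. Proof. by []. Qed.

End FpsZmodule.

Section FpsRing.
Variable R : comNzRingType.
Implicit Types F G H : {fps R}.

Definition fps_one : {fps R} := Fps (fun n => (n == 0%N)%:R).
Definition fps_mul F G : {fps R} :=
  Fps (fun n => \sum_(j < n.+1) coefs F j * coefs G (n - j)).

Fact fps_mulC : commutative fps_mul.
Proof.
move=> F G; apply/fpsP => n /=.
rewrite (reindex_inj rev_ord_inj) /=; apply: eq_bigr => j _.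
by rewrite (sub_ordK j) mulrC.
Qed.

Fact fps_mulA : associative fps_mul.
Proof.
move=> F G H; rewrite [RHS]fps_mulC; apply/fpsP => n /=.
pose c j k := coefs F j * (coefs G (n - j - k) * coefs H k).
transitivity (\sum_(j < n.+1) \sum_(k < n.+1 | (k <= n - j)%N) c j k).
  apply: eq_bigr => /= j _; rewrite (_ : \sum_(i < _) _ = coefs (fps_mul H G) (n - j)).
    rewrite /= big_distrr /= (big_ord_narrow_leq (leq_subr _ _)) /=.
    by apply: eq_bigr => k _; rewrite /c [coefs H _ * _]mulrC.
  by rewrite fps_mulC.
rewrite (exchange_big_dep predT) //=; apply: eq_bigr => k _.
transitivity (\sum_(j < n.+1 | (j <= n - k)%N) c j k).
  by apply: eq_bigl => j; rewrite -ltnS -(ltnS j) -!subSn ?leq_ord // ltn_subRL addnC -ltn_subRL.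
rewrite (big_ord_narrow_leq (leq_subr _ _)) /= big_distrr /=.
by apply: eq_bigr => j _; rewrite /c /= mulrA mulrC -!subnDA addnC.
Qed.

Fact fps_mul1 : left_id fps_one fps_mul.
Proof.
move=> F; apply/fpsP => n /=.
rewrite big_ord_recl /= mul1r subn0 big1 ?addr0 // => j _.
by rewrite /bump /= mul0r.
Qed.

Fact fps_mulDl : left_distributive fps_mul +%R.
Proof.
move=> F G H; apply/fpsP => n /=; rewrite -big_split /=.
by apply: eq_bigr => j _; rewrite mulrDl.
Qed.

Fact fps_one_neq0 : fps_one != 0.
Proof.
by apply/eqP => /fpsP/(_ 0%N) /= /eqP; rewrite oner_eq0.
Qed.

HB.instance Definition _ := GRing.Zmodule_isComNzRing.Build {fps R}
  fps_mulA fps_mulC fps_mul1 fps_mulDl fps_one_neq0.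

Lemma coefsM F G n :
  coefs (F * G) n = \sum_(j < n.+1) coefs F j * coefs G (n - j).
Proof. by []. Qed.
Lemma coefs1 n : coefs (1 : {fps R}) n = (n == 0%N)%:R.
Proof. by []. Qed.

(* Invertibility and the inverse are defined classically. *)
Definition fps_unit : {pred {fps R}} := fun F => `[< exists G, G * F = 1 >].
Definition fps_inv F : {fps R} :=
  if pselect (exists G, G * F = 1) is left invF then projT1 (cid invF) else F.

Fact fps_mulVx : {in fps_unit, left_inverse 1 fps_inv *%R}.
Proof.
move=> F /asboolP invF; rewrite /fps_inv; case: pselect => // invF'.
by case: cid.
Qed.
Fact fps_unitPl F G : G * F = 1 -> fps_unit F.
Proof. by move=> GF1; apply/asboolP; exists G. Qed.
Fact fps_invr_out : {in [predC fps_unit], fps_inv =1 id}.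
Proof.
move=> F /= ninvF; rewrite /fps_inv; case: pselect => // invF.
by case/negP: ninvF; apply/asboolP.
Qed.

HB.instance Definition _ := GRing.ComNzRing_hasMulInverse.Build {fps R}
  fps_mulVx fps_unitPl fps_invr_out.

Definition fps_of_poly (p : {poly R}) : {fps R} := Fps (fun n => p`_n).

Fact fps_of_poly_is_zmod_morphism : zmod_morphism fps_of_poly.
Proof. by move=> p q; apply/fpsP => n /=; rewrite coefB. Qed.
Fact fps_of_poly_is_monoid_morphism : monoid_morphism fps_of_poly.
Proof.
split; first by apply/fpsP => n /=; rewrite coef1.
by move=> p q; apply/fpsP => n /=; rewrite coefM.
Qed.
HB.instance Definition _ := GRing.isZmodMorphism.Build {poly R} {fps R}
  fps_of_poly fps_of_poly_is_zmod_morphism.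
HB.instance Definition _ := GRing.isMonoidMorphism.Build {poly R} {fps R}
  fps_of_poly fps_of_poly_is_monoid_morphism.

Lemma fps_of_poly_inj : injective fps_of_poly.
Proof. by move=> p q /fpsP eqpq; apply/polyP => n; apply: eqpq. Qed.

Definition fps_deriv F : {fps R} := Fps (fun n => coefs F n.+1 *+ n.+1).

End FpsRing.

Section FpsIntegral.
Variable R : idomainType.
Implicit Types F G : {fps R}.

Fact fps_order F : F != 0 ->
  exists2 m, coefs F m != 0 & forall k, (k < m)%N -> coefs F k = 0.
Proof.
move=> nzF; have exF : exists m, coefs F m != 0.
  apply: contrapT => nexF; case/eqP: nzF; apply/fpsP => n.
  by apply/eqP/negPn/negP => nz; apply: nexF; exists n.
case: (ex_minnP exF) => m nzm minm; exists m => // k ltkm.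
by apply/eqP/negPn/negP => /minm; rewrite leqNgt ltkm.
Qed.

Fact fps_integral : GRing.integral_domain_axiom {fps R}.
Proof.
move=> F G FG0; apply/negPn/negP; rewrite negb_or => /andP[].
move=> /fps_order[m nzFm minF] /fps_order[k nzGk minG].
have /eqP := congr1 (fun H => coefs H (m + k)%N) FG0.
have ltm : (m < (m + k).+1)%N by rewrite ltnS leq_addr.
rewrite /= (bigD1 (Ordinal ltm)) //= big1 ?addr0 => [|j neqjm].
  by rewrite addKn mulf_eq0 (negPf nzFm) (negPf nzGk).
case: (ltngtP j m) => [ltjm | ltmj | eqjm].
- by rewrite minF ?mul0r.
- rewrite [coefs G _]minG ?mulr0 // ltn_subLR ?ltn_add2r //.
  by rewrite -ltnS ltn_ord.
by case/eqP: neqjm; apply: val_inj.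
Qed.

HB.instance Definition _ :=
  GRing.ComUnitRing_isIntegral.Build {fps R} fps_integral.
End FpsIntegral.

Definition fps_map (R R' : Type) (f : R -> R') (F : {fps R}) : {fps R'} :=
  Fps (fun n => f (coefs F n)).

(** * Algebraic and D-finite series *)

(* A series F(t) with coefficients in A, where A is itself a ring of
   polynomials over Q in the remaining variables, so that {poly A} is the ring
   of polynomials over Q in all the variables of F. *)
Definition algebraic_series (A : comNzRingType) (F : {fps A}) : Prop :=
  exists2 P : {poly {poly A}}, P != 0 & root (map_poly (@fps_of_poly A) P) F.

Section RatfunToFps.
Variable A : idomainType.
Local Notation "x %:F" := (FracField.tofrac x).

(* The inclusion of Frac(A[t]) into Frac(A[[t]]). *)
Definition ratfun_to_fps (z : {fraction {poly A}}) : {fraction {fps A}} :=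
  (fps_of_poly (\n_(repr z)))%:F / (fps_of_poly (\d_(repr z)))%:F.

Lemma fps_of_poly_eq0 (p : {poly A}) : (fps_of_poly p == 0) = (p == 0).
Proof. by rewrite -(rmorph0 (@fps_of_poly A)) (inj_eq (@fps_of_poly_inj A)). Qed.

Lemma frac_numden (R : idomainType) (z : {fraction R}) :
  z = (\n_(repr z))%:F / (\d_(repr z))%:F.
Proof.
have nzd : (\d_(repr z))%:F != 0 :> {fraction R}.
  by rewrite tofrac_eq0 denom_ratioP.
apply: (mulIf nzd); rewrite divfK // -{1}[z]reprK.
move: (denom_ratioP (repr z)); move: (repr z) => r nzr; unlock FracField.tofrac.
rewrite -[LHS]FracField.pi_mul; apply/eqmodP; rewrite /= FracField.equivfE /FracField.mulf /=.
by rewrite !numden_Ratio ?mulf_neq0 ?oner_eq0 // !mulr1 mulrC.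
Qed.

Lemma ratfun_to_fps_div (p q : {poly A}) : q != 0 ->
  ratfun_to_fps (p%:F / q%:F) = (fps_of_poly p)%:F / (fps_of_poly q)%:F.
Proof.
move=> nzq; rewrite /ratfun_to_fps; move: (frac_numden (p%:F / q%:F)).
move: (repr (p%:F / q%:F)) => r; have nzd : \d_r != 0 := denom_ratioP r.
move/eqP; rewrite eqr_div ?tofrac_eq0 // -!tofracM tofrac_eq => /eqP e.
apply/esym/eqP; rewrite eqr_div ?tofrac_eq0 ?fps_of_poly_eq0 //.
by rewrite -!tofracM -!rmorphM e.
Qed.

Lemma frac_divP (R : idomainType) (z : {fraction R}) :
  exists2 pq : R * R, pq.2 != 0 & z = pq.1%:F / pq.2%:F.
Proof.
exists (repr z : R * R); [exact: denom_ratioP | exact: frac_numden].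
Qed.

Fact ratfun_to_fps_is_zmod_morphism : zmod_morphism ratfun_to_fps.
Proof.
move=> z w; have [[p q] /= nzq ->] := frac_divP z.
have [[p' q'] /= nzq' ->] := frac_divP w.
rewrite -mulNr addf_div ?tofrac_eq0 // -tofracN -!tofracM -tofracD.
rewrite !ratfun_to_fps_div ?mulf_neq0 // -mulNr addf_div ?tofrac_eq0 ?fps_of_poly_eq0 //.
by rewrite -tofracN -!tofracM -tofracD rmorphD !rmorphM rmorphN.
Qed.

Fact ratfun_to_fps_is_monoid_morphism : monoid_morphism ratfun_to_fps.
Proof.
split=> [|z w].
  rewrite -[1 in LHS]divr1 -tofrac1 ratfun_to_fps_div ?oner_eq0 //.
  by rewrite rmorph1 divr1.
have [[p q] /= nzq ->] := frac_divP z.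
have [[p' q'] /= nzq' ->] := frac_divP w.
rewrite mulf_div -!tofracM !ratfun_to_fps_div ?mulf_neq0 // mulf_div.
by rewrite -!tofracM !rmorphM.
Qed.

HB.instance Definition _ := GRing.isZmodMorphism.Build
  {fraction {poly A}} {fraction {fps A}} ratfun_to_fps
  ratfun_to_fps_is_zmod_morphism.
HB.instance Definition _ := GRing.isMonoidMorphism.Build
  {fraction {poly A}} {fraction {fps A}} ratfun_to_fps
  ratfun_to_fps_is_monoid_morphism.
End RatfunToFps.

(* Linear algebra in a field E seen as a K-vector space via iota : K -> E. *)
Section SpanOver.
Variables (K E : fieldType) (iota : {rmorphism K -> E}).

Definition span_over (G : nat -> E) (z : E) : Prop :=
  exists n (c : 'I_n -> K), z = \sum_(i < n) iota (c i) * G i.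

Definition finite_dim_over (W : E -> Prop) : Prop :=
  exists d (b : 'I_d -> E), forall z : E,
    W z <-> exists c : 'I_d -> K, z = \sum_(i < d) iota (c i) * b i.
End SpanOver.

(* With respect to the variable t of F(t); A is a ring of polynomials over Q
   in the remaining variables, so that Frac(A[t]) is the field of rational
   functions over Q in all the variables of F. *)
Definition D_finite (A : idomainType) (F : {fps A}) : Prop :=
  finite_dim_over (@ratfun_to_fps A)
    (span_over (@ratfun_to_fps A)
       (fun m => FracField.tofrac (iter m (@fps_deriv A) F))).

(** * Hadamard product *)

(* Series in R[v][[t]] and R[[v]]: with F = \sum_k a_k(t) v^k, a_k in R[[t]],
   and G = \sum_k b_k v^k, the Hadamard product is \sum_k a_k(t) b_k v^k, which
   lies in R[v][[t]] since each power of t carries finitely many powers of v. *)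
Definition hadamard_v (R : comNzRingType) (F : {fps {poly R}}) (G : {fps R}) :
    {fps {poly R}} :=
  Fps (fun n => \poly_(k < size (coefs F n)) ((coefs F n)`_k * coefs G k)).

Definition eval_v (R : comNzRingType) (v : R) (F : {fps {poly R}}) : {fps R} :=
  fps_map (fun p => p.[v]) F.

(** * Walks *)

Section Walks.
Variables (G : zmodType) (inside : pred G) (A : finType) (step : A -> G).

Definition endpoint (w : seq A) : G := \sum_(a <- w) step a.

Definition confined (w : seq A) : bool :=
  all (fun k => inside (endpoint (take k w))) (iota 0 (size w).+1).

Definition walks (n : nat) : {set n.-tuple A} := [set w : n.-tuple A | confined w].
End Walks.

Definition in_N (p : int) : bool := 0 <= p.
Definition in_N2 (p : int * int) : bool := (0 <= p.1) && (0 <= p.2).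

(* In the three generating functions the absolute values only convert int to
   nat: endpoints of confined walks are nonnegative.  The lemmas quadrant_gfE,
   C1E and C2E below identify the coefficients as numbers of walks. *)

(* In Q[y][x] = {poly {poly rat}}, 'X is x and 'X%:P is y. *)
Definition quadrant_gf (S : {fset int * int}) : {fps {poly {poly rat}}} :=
  Fps (fun n => \sum_(w in walks in_N2 (fun s : S => val s) n)
    let p := endpoint (fun s : S => val s) w in
    'X ^+ `|p.1|%N * 'X%:P ^+ `|p.2|%N).

(* Steps in the multiset union of U and V, as the disjoint sum. *)
Definition union_step (U V : {fset int}) (a : U + V) : int :=
  match a with inl u => val u | inr v => val v end.

Definition V_steps (U V : {fset int}) (w : seq (U + V)) : nat :=
  count (fun a => if a is inr _ then true else false) w.

(* In Q[x][v] = {poly {poly rat}}, 'X is v and 'X%:P is x. *)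
Definition C1 (U V : {fset int}) : {fps {poly {poly rat}}} :=
  Fps (fun n => \sum_(w in walks in_N (@union_step U V) n)
    'X%:P ^+ `|endpoint (@union_step U V) w|%N * 'X ^+ V_steps w).

Definition C2 (T : {fset int}) : {fps {poly rat}} :=
  Fps (fun n => \sum_(w in walks in_N (fun s : T => val s) n)
    'X ^+ `|endpoint (fun s : T => val s) w|%N).

(* C1 seen in Q[y][x][v][[t]] and C2 seen in Q[y][x][[v]]: x is still the
   indeterminate of {poly {poly rat}} and y the constant 'X%:P. *)
Definition C1_xy (U V : {fset int}) : {fps {poly {poly {poly rat}}}} :=
  fps_map (map_poly (map_poly polyC)) (C1 U V).
Definition C2_xy (T : {fset int}) : {fps {poly {poly rat}}} :=
  fps_map polyC (C2 T).

Lemma quadrant_gfE (S : {fset int * int}) (i j n : nat) :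
  (coefs (quadrant_gf S) n)`_i`_j =
  #|[set w in walks in_N2 (fun s : S => val s) n |
       endpoint (fun s : S => val s) w == (i%:Z, j%:Z)]|%:R.
Proof.
rewrite /= !coef_sum -sum1_card natr_sum [RHS]big_mkcond /=.
rewrite [LHS]big_mkcond; apply: eq_bigr => w _.
rewrite [X in _ = (if X then _ else _)]inE.
case: ifP => //=; rewrite inE => /allP conf_w.
have := conf_w n; rewrite mem_iota size_tuple ltnSn => /(_ isT).
rewrite take_oversize ?size_tuple //.
case: (endpoint _ w) => -[a|a] [b|b] //= _.
rewrite -polyC_exp coefMC coefXn xpair_eqE !eqz_nat [i == _]eq_sym.
by case: (a == i); rewrite /= ?mulr0n ?mul1r ?mul0r ?coefXn ?coef0 // eq_sym; case: (b == j).
Qed.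

Lemma C1E (U V : {fset int}) (i k n : nat) :
  (coefs (C1 U V) n)`_k`_i =
  #|[set w in walks in_N (@union_step U V) n |
       (endpoint (@union_step U V) w == i%:Z) && (V_steps w == k)]|%:R.
Proof.
rewrite /= !coef_sum -sum1_card natr_sum [RHS]big_mkcond /=.
rewrite [LHS]big_mkcond; apply: eq_bigr => w _.
rewrite [X in _ = (if X then _ else _)]inE.
case: ifP => //=; rewrite inE => /allP conf_w.
have := conf_w n; rewrite mem_iota size_tuple ltnSn => /(_ isT).
rewrite take_oversize ?size_tuple //.
case: (endpoint _ w) => // a _ /=.
rewrite -polyC_exp coefCM.
rewrite coefXn eqz_nat [k == _]eq_sym andbC.
by case: (_ == k); rewrite /= ?mulr0n ?mulr1 ?mulr0 ?coefXn ?coef0 // eq_sym; case: (a == i).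
Qed.

Lemma C2E (T : {fset int}) (j n : nat) :
  (coefs (C2 T) n)`_j =
  #|[set w in walks in_N (fun s : T => val s) n |
       endpoint (fun s : T => val s) w == j%:Z]|%:R.
Proof.
rewrite /= !coef_sum -sum1_card natr_sum [RHS]big_mkcond /=.
rewrite [LHS]big_mkcond; apply: eq_bigr => w _.
rewrite [X in _ = (if X then _ else _)]inE.
case: ifP => //=; rewrite inE => /allP conf_w.
have := conf_w n; rewrite mem_iota size_tuple ltnSn => /(_ isT).
rewrite take_oversize ?size_tuple //.
case: (endpoint _ w) => // a _ /=.
by rewrite coefXn eqz_nat eq_sym; case: eqP.
Qed.

(** * Step polynomials *)

(* Laurent polynomials over Q in x and y, as elements of Q(x,y), the fraction
   field of Q[y][x]. *)
Definition varx : {fraction {poly {poly rat}}} := FracField.tofrac 'X.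
Definition vary : {fraction {poly {poly rat}}} := FracField.tofrac 'X%:P.

Definition step_poly (S : {fset int * int}) : {fraction {poly {poly rat}}} :=
  \sum_(s <- S) varx ^ s.1 * vary ^ s.2.

Definition gen_poly (z : {fraction {poly {poly rat}}}) (U : {fset int}) :
    {fraction {poly {poly rat}}} :=
  \sum_(i <- U) z ^ i.

(* Main.v *)
From HB Require Import structures.
Require Import Defs.
From mathcomp Require Import all_boot all_order all_algebra finmap all_field.
From mathcomp Require Import boolp ring zify.

Set Implicit Arguments.
Unset Strict Implicit.
Unset Printing Implicit Defensive.

Import Order.TTheory GRing.Theory Num.Theory.
Local Open Scope ring_scope.

Local Notation "x %:F" := (FracField.tofrac x).
Local Notation Qyx := {poly {poly rat}}.

(** Product formula. Comparing the monomials of S = U + V T, the steps of the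
    model are the (u,0), with u in U, and the (v,s), with v in V and s in T. So a
    quadrant walk is a walk in x with steps in U and V, together with a walk in
    y with steps in T that advances exactly when the first one takes a step in
    V. In terms of series, both sides of the formula satisfy the recurrence
    Q_{n+1} = [nonnegative part of S Q_n] (quadrant_paired).

    Algebraicity. Let F(x;t) be a weighted generating function of walks on the
    half-line, with steps at least -a. Its functional equation is K F = N, with
    K = x^a - t W(x) a known polynomial and N monic of degree a in x, with
    unknown coefficients in t. Since 1/F is a power series in t over the
    polynomials in x, uniqueness of Weierstrass division by N shows that N
    divides K as a polynomial in x. The coefficients of a monic factor of K are
    algebraic over the field generated by those of K, because its roots are
    roots of K. Hence F = N / K is algebraic (walk_series_algebraic).

    D-finiteness. If u marks the steps in U, a walk of length n with k steps in
    V is marked by u^{n-k}. Therefore Q is the diagonal, in t and u, of the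
    product D of C_1 (with this marking) and C_2(y;u), and D is an algebraic
    power series in t and u. That the diagonal of D is D-finite follows from an
    argument of Lipshitz. The derivatives of D remain, up to powers of a
    common denominator q, in a module of finite rank over the polynomials in t
    and u (differential_family). Let delta be the derivation for which u has
    derivative 1 and tu is a constant. With powers of tu, of t d/dt and of delta
    up to N one forms N^3 operators, whereas their values at D lie in a space
    of dimension of order N^2; so a linear combination of them annihilates D
    (lipshitz_relation). Its terms of least order in delta yield a differential
    equation for the diagonal (diagonal_differential_equation), because the
    other terms have no diagonal part, just as derivatives have no residue. *)

(** * Ring morphisms between rings of power series *)

Section FpsMap.
Variables (R R' : comNzRingType) (f : {rmorphism R -> R'}).

Fact fps_map_is_zmod_morphism : zmod_morphism (fps_map f).
Proof. by move=> F G; apply/fpsP => n /=; rewrite rmorphB. Qed.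

Fact fps_map_is_monoid_morphism : monoid_morphism (fps_map f).
Proof.
split=> [|F G]; apply/fpsP => n /=; first by rewrite rmorph_nat.
by rewrite rmorph_sum; apply: eq_bigr => i _; rewrite rmorphM.
Qed.

HB.instance Definition _ := GRing.isZmodMorphism.Build
  {fps R} {fps R'} (fps_map f) fps_map_is_zmod_morphism.
HB.instance Definition _ := GRing.isMonoidMorphism.Build
  {fps R} {fps R'} (fps_map f) fps_map_is_monoid_morphism.

Lemma fps_map_of_poly (p : {poly R}) :
  fps_map f (fps_of_poly p) = fps_of_poly (map_poly f p).
Proof. by apply/fpsP => n /=; rewrite coef_map. Qed.
End FpsMap.

Lemma fps_map_inj (R R' : Type) (f : R -> R') :
  injective f -> injective (fps_map f).
Proof. by move=> injf F G /fpsP e; apply/fpsP => n; apply: injf (e n). Qed.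

Lemma map_poly_inj_morph (R R' : nzRingType) (f : {rmorphism R -> R'}) :
  injective f -> injective (map_poly f).
Proof. by move=> injf; apply: map_inj_poly (rmorph0 f). Qed.

(** * Fields of fractions *)

(** The notion algebraicOver, for an arbitrary ring of scalars in place of a
    field; algebraic_series is the instance of fps_of_poly. *)
Definition algebraic_elt (R E : comNzRingType) (f : R -> E) (z : E) : Prop :=
  exists2 P : {poly R}, P != 0 & root (map_poly f P) z.

Section FracLift.
Variables (R : idomainType) (K : fieldType) (g : {rmorphism R -> K}).
Hypothesis g_inj : injective g.

Definition frac_lift (z : {fraction R}) : K :=
  g \n_(repr z) / g \d_(repr z).

Let g_eq0 x : (g x == 0) = (x == 0).
Proof. by rewrite -(rmorph0 g) (inj_eq g_inj). Qed.

Lemma frac_lift_div p q : q != 0 -> frac_lift (p%:F / q%:F) = g p / g q.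
Proof.
move=> nzq; rewrite /frac_lift; move: (frac_numden (p%:F / q%:F)).
move: (repr (p%:F / q%:F)) => r; have nzd : \d_r != 0 := denom_ratioP r.
move/eqP; rewrite eqr_div ?tofrac_eq0 // -!tofracM tofrac_eq => /eqP e.
by apply/esym/eqP; rewrite eqr_div ?g_eq0 // -!rmorphM e.
Qed.

Lemma frac_lift_tofrac p : frac_lift p%:F = g p.
Proof.
rewrite -[in LHS](divr1 p%:F) -tofrac1 frac_lift_div ?oner_eq0 //.
by rewrite rmorph1 divr1.
Qed.

Fact frac_lift_is_zmod_morphism : zmod_morphism frac_lift.
Proof.
move=> z w; have [[p q] /= nzq ->] := frac_divP z.
have [[p' q'] /= nzq' ->] := frac_divP w.
rewrite -mulNr addf_div ?tofrac_eq0 // -tofracN -!tofracM -tofracD.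
rewrite !frac_lift_div ?mulf_neq0 // -mulNr addf_div ?g_eq0 //.
by rewrite rmorphD !rmorphM rmorphN.
Qed.

Fact frac_lift_is_monoid_morphism : monoid_morphism frac_lift.
Proof.
split=> [|z w]; first by rewrite -tofrac1 frac_lift_tofrac rmorph1.
have [[p q] /= nzq ->] := frac_divP z.
have [[p' q'] /= nzq' ->] := frac_divP w.
rewrite mulf_div -!tofracM !frac_lift_div ?mulf_neq0 // mulf_div.
by rewrite !rmorphM.
Qed.

(** Being a morphism depends on the injectivity of g, a hypothesis that
    instance inference does not supply: the structure is packed explicitly. *)
Definition frac_lift_rmorphism : {rmorphism {fraction R} -> K} :=
  HB.pack_for {rmorphism {fraction R} -> K} frac_lift
    (GRing.isZmodMorphism.Build _ _ frac_lift frac_lift_is_zmod_morphism)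
    (GRing.isMonoidMorphism.Build _ _ frac_lift frac_lift_is_monoid_morphism).

Lemma clear_denominators (P : {poly {fraction R}}) :
  exists2 d : R, d != 0 &
    exists P' : {poly R}, d%:F *: P = map_poly (@FracField.tofrac R) P'.
Proof.
elim/poly_ind: P => [|P c [d nzd [P' defP']]].
  by exists 1; rewrite ?oner_eq0 //; exists 0; rewrite scaler0 rmorph0.
have [[n m] /= nzm ->] := frac_divP c.
exists (d * m); first by rewrite mulf_neq0.
exists (m *: P' * 'X + (d * n)%:P).
rewrite [RHS]rmorphD (rmorphM _ _ 'X) /= map_polyX map_polyZ map_polyC /= -defP'.
rewrite scalerDr -!scalerAl scalerA -tofracM [m * d]mulrC; congr (_ + _).
rewrite -!mul_polyC -polyCM !tofracM mulrACA divff ?mulr1 1?mulrC //.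
by rewrite tofrac_eq0.
Qed.

Lemma algebraic_frac z :
  algebraic_elt g z <-> algebraicOver frac_lift_rmorphism z.
Proof.
split=> -[P nzP Pz0].
  exists (map_poly (@FracField.tofrac R) P).
    by rewrite map_poly_eq0_id0 // tofrac_eq0 lead_coef_eq0.
  rewrite -map_poly_comp_id0 ?rmorph0 //.
  by rewrite (@eq_map_poly _ _ _ g) // => x; apply: frac_lift_tofrac.
have [d nzd [P' defP']] := clear_denominators P.
exists P'.
  apply: contraNneq nzP => P'0; move/eqP: defP'.
  by rewrite P'0 rmorph0 scaler_eq0 tofrac_eq0 (negPf nzd).
have -> : map_poly g P' = g d *: map_poly frac_lift_rmorphism P.
  rewrite -[g d]frac_lift_tofrac -[frac_lift d%:F]/(frac_lift_rmorphism d%:F).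
  rewrite -map_polyZ defP' -map_poly_comp_id0 ?rmorph0 //.
  by apply: eq_map_poly => x; rewrite /= frac_lift_tofrac.
by rewrite rootZ // g_eq0.
Qed.
End FracLift.

(** * Algebraic elements of an integral domain *)

(** Changing the scalars by an injection g, and the series by a compatible
    morphism h, turns an annihilating polynomial into another one. *)
Lemma algebraic_elt_morph (R R' E E' : comNzRingType) (f : {rmorphism R -> E})
    (f' : {rmorphism R' -> E'}) (g : {rmorphism R -> R'})
    (h : {rmorphism E -> E'}) z :
    injective g -> (forall a, h (f a) = f' (g a)) ->
  algebraic_elt f z -> algebraic_elt f' (h z).
Proof.
move=> injg hf [P nzP /rootP Pz0]; exists (map_poly g P).
  by rewrite -(rmorph0 (map_poly g)) (inj_eq (map_poly_inj_morph injg)).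
rewrite -map_poly_comp (@eq_map_poly _ _ _ (h \o f)) => [|a /=]; last first.
  by rewrite hf.
by apply/rootP; rewrite map_poly_comp horner_map Pz0 rmorph0.
Qed.

Section AlgebraicDomain.
Variables (R E : idomainType) (f : {rmorphism R -> E}).
Hypothesis f_inj : injective f.

Let g : {rmorphism R -> {fraction E}} := (@FracField.tofrac E) \o f.
Let g_inj : injective g.
Proof. by move=> a b /eqP; rewrite /= tofrac_eq => /eqP/f_inj. Qed.
Let K := frac_lift_rmorphism g_inj.

(** This reduces the closure properties below to those of algebraic elements in
    a field extension. *)
Lemma algebraic_tofrac z : algebraic_elt f z <-> algebraicOver K z%:F.
Proof.
rewrite /K -algebraic_frac; split=> -[P nzP]; last (move=> Pz0; exists P => //).
  move/rootP => Pz0; exists P => //.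
  rewrite map_poly_comp; apply/rootP.
  by rewrite horner_map Pz0 rmorph0.
move: Pz0; rewrite map_poly_comp => /rootP; rewrite horner_map => /eqP.
by rewrite tofrac_eq0.
Qed.

Lemma algebraic_dom_id a : algebraic_elt f (f a).
Proof.
apply/algebraic_tofrac; rewrite -[(f a)%:F]/(g a) -(frac_lift_tofrac g_inj).
exact: algebraic_id.
Qed.

Lemma algebraic_domD y z :
  algebraic_elt f y -> algebraic_elt f z -> algebraic_elt f (y + z).
Proof.
move=> /algebraic_tofrac algy /algebraic_tofrac algz; apply/algebraic_tofrac.
by rewrite tofracD; exact: (algebraic_add algy algz).
Qed.

Lemma algebraic_domM y z :
  algebraic_elt f y -> algebraic_elt f z -> algebraic_elt f (y * z).
Proof.
move=> /algebraic_tofrac algy /algebraic_tofrac algz; apply/algebraic_tofrac.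
by rewrite tofracM; exact: (algebraic_mul algy algz).
Qed.

Lemma algebraic_dom_sum (I : finType) (F : I -> E) :
  (forall i, algebraic_elt f (F i)) -> algebraic_elt f (\sum_i F i).
Proof.
move=> algF; apply: big_ind => //; last exact: algebraic_domD.
by rewrite -(rmorph0 f); apply: algebraic_dom_id.
Qed.

Lemma algebraic_dom_div y z w : y != 0 -> y * z = w ->
  algebraic_elt f y -> algebraic_elt f w -> algebraic_elt f z.
Proof.
move=> nzy <- /algebraic_tofrac algy /algebraic_tofrac algw.
apply/algebraic_tofrac; have -> : z%:F = (y * z)%:F / y%:F.
  by rewrite tofracM mulrC mulKf ?tofrac_eq0.
exact: (algebraic_div algw algy).
Qed.
End AlgebraicDomain.

(** * Monic factors of a polynomial have algebraic coefficients *)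

Lemma irreducible_divisor (E : fieldType) (p : {poly E}) :
  (1 < size p)%N -> exists2 q, irreducible_poly q & q %| p.
Proof.
elim: (size p) {-2}p (leqnn (size p)) => [|n IHn] {}p.
  by rewrite leqn0 => /eqP->.
move=> lepn gtp1; have [irr_p | nirr_p] := pselect (irreducible_poly p).
  by exists p.
have nzp : p != 0 by rewrite -size_poly_eq0 -lt0n ltnW.
have [q [szq qdvdp nqp]] :
  exists q : {poly E}, [/\ size q != 1%N, q %| p & ~~ (q %= p)].
  apply: contrapT => nex; apply: nirr_p; split=> // q szq qdvdp.
  by apply/negPn/negP => nqp; apply: nex; exists q.
have nzq : q != 0 by apply: contraTneq qdvdp => ->; rewrite dvd0p.
have gtq1 : (1 < size q)%N by rewrite ltn_neqAle eq_sym szq size_poly_gt0.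
have ltqp : (size q < size p)%N.
  rewrite ltn_neqAle dvdp_leq // andbT; apply: contraNneq nqp => e.
  by rewrite -dvdp_size_eqp ?e.
have [r irr_r rdvdq] := IHn q (leq_trans ltqp lepn) gtq1.
by exists r => //; apply: dvdp_trans rdvdq qdvdp.
Qed.

Lemma adjoin_root (E : fieldType) (p : {poly E}) : (1 < size p)%N ->
  exists (L : fieldType) (j : {rmorphism E -> L}) (x : L),
    root (map_poly j p) x.
Proof.
case/irreducible_divisor => q irr_q /dvdpP[r ->].
have [L _ [x rootx _]] := irredp_FAdjoin irr_q.
by exists L, (in_alg L), x; rewrite rmorphM rootM rootx orbT.
Qed.

(** In a splitting field the roots of the factor N are roots of K, hence
    algebraic, and the coefficients of N are polynomials in its roots; the
    splitting field is reached one root at a time. *)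
Lemma algebraic_monic_factor_field (F E : fieldType) (iota : {rmorphism F -> E})
    (K : {poly F}) (N : {poly E}) :
    K != 0 -> N %| map_poly iota K -> N \is monic ->
  forall i, algebraicOver iota N`_i.
Proof.
move=> nzK; have [n] := ubnP (size N); elim: n E iota N => // n IHn E iota N.
have [leN1 _ _ monN i|] := leqP (size N) 1.
  have -> : N = 1.
    move: monN; rewrite (size1_polyC leN1) => /monicP.
    by rewrite lead_coefC => ->.
  by rewrite coef1 -(rmorph_nat iota); apply: algebraic_id.
case/adjoin_root => L [j [x /factor_theorem[M defN]]] ltNn dvdNK monN i.
pose jL : {rmorphism F -> L} := j \o iota.
have defK : map_poly jL K = map_poly j (map_poly iota K) by rewrite map_poly_comp.
have monM : M \is monic by rewrite -(monicMr _ (monicXsubC x)) -defN map_monic.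
have dvdMK : M %| map_poly jL K.
  rewrite defK; apply: (dvdp_trans _ (_ : map_poly j N %| _)).
    by rewrite defN dvdp_mulr.
  by rewrite dvdp_map.
have leMn : (size M < n)%N.
  move: ltNn; rewrite -(size_map_poly j) defN.
  by rewrite size_Mmonic ?monic_neq0 ?monicXsubC // size_XsubC addn2.
have algM := IHn L jL M leMn dvdMK monM.
have algx : algebraicOver jL x.
  exists K => //; rewrite defK; case/dvdpP: dvdNK => r ->.
  by rewrite rmorphM /= defN !rootM root_XsubC eqxx !orbT.
have : algebraicOver jL (j N`_i).
  rewrite -coef_map defN mulrBr coefB coefMX coefMC.
  have algcM k : algebraicOver jL M`_k by apply: algM.
  apply: algebraic_sub; last by apply: algebraic_mul.
  by case: (i == 0%N); [apply: algebraic0 | apply: algcM].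
case=> P nzP Pz0; exists P => //; move: Pz0.
by rewrite /jL map_poly_comp fmorph_root.
Qed.

Lemma algebraic_monic_factor (R E : idomainType) (f : {rmorphism R -> E})
    (K : {poly R}) (N H : {poly E}) :
    injective f -> K != 0 -> N \is monic -> map_poly f K = N * H ->
  forall i, algebraic_elt f N`_i.
Proof.
move=> injf nzK monN defK i; apply/(algebraic_tofrac injf).
rewrite -coef_map; set iota := frac_lift_rmorphism _.
apply: (@algebraic_monic_factor_field _ _ _ (map_poly (@FracField.tofrac R) K)).
- by rewrite map_poly_eq0_id0 // tofrac_eq0 lead_coef_eq0.
- have -> : map_poly iota (map_poly (@FracField.tofrac R) K) =
            map_poly (@FracField.tofrac E) (map_poly f K).
    rewrite -!map_poly_comp; apply: eq_map_poly => x /=.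
    by rewrite frac_lift_tofrac //= => a b /eqP; rewrite tofrac_eq => /eqP/injf.
  by rewrite defK rmorphM dvdp_mulr.
- apply/monicP; rewrite lead_coef_map_inj ?(monicP monN) ?tofrac1 ?tofrac0 //.
  by move=> a b /eqP; rewrite tofrac_eq => /eqP.
Qed.

(** * Walks on the half-line have an algebraic generating function *)

Section FpsCoefs.
Variable R : comNzRingType.
Implicit Types F G : {fps R}.

Lemma coefs_sum (I : Type) (r : seq I) (P : pred I) (F : I -> {fps R}) n :
  coefs (\sum_(i <- r | P i) F i) n = \sum_(i <- r | P i) coefs (F i) n.
Proof. by elim/big_rec2: _ => // i x y _ <-. Qed.

Definition fpsC (c : R) : {fps R} := fps_of_poly c%:P.

Lemma coefs_fpsC c n : coefs (fpsC c) n = if n == 0%N then c else 0.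
Proof. exact: coefC. Qed.

Lemma coefsCM c F n : coefs (fpsC c * F) n = c * coefs F n.
Proof.
rewrite coefsM big_ord_recl coefs_fpsC subn0 big1 ?addr0 // => i _.
by rewrite coefs_fpsC mul0r.
Qed.

Lemma coefsXM F n :
  coefs (fps_of_poly 'X * F) n = if n is m.+1 then coefs F m else 0.
Proof.
case: n => [|n]; rewrite coefsM big_ord_recl /= coefX mul0r add0r.
  by rewrite big_ord0.
rewrite big_ord_recl /= coefX mul1r subSS subn0 big1 ?addr0 // => i _.
by rewrite coefX mul0r.
Qed.
End FpsCoefs.

Section PolyFps.
Variable B : idomainType.

(** The inclusion of B[[t]][x] into B[x][[t]]. *)
Definition fps_of_polyfps : {poly {fps B}} -> {fps {poly B}} :=
  horner_eval (fpsC 'X) \o map_poly (fps_map polyC).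
HB.instance Definition _ := GRing.RMorphism.on fps_of_polyfps.

Lemma fps_of_polyfpsE p :
  fps_of_polyfps p = \sum_(i < size p) fps_map polyC p`_i * fpsC ('X^i).
Proof.
rewrite /fps_of_polyfps /= /horner_eval horner_coef size_map_inj_poly //; last first.
- by apply: fps_map_inj; apply: polyC_inj.
by apply: eq_bigr => i _; rewrite coef_map -!rmorphXn.
Qed.

Lemma coef_fps_of_polyfps p n i :
  (coefs (fps_of_polyfps p) n)`_i = coefs p`_i n.
Proof.
rewrite fps_of_polyfpsE coefs_sum coef_sum.
under eq_bigr => j _ do rewrite mulrC coefsCM /= coefMC coefXn.
have [lti|lei] := ltnP i (size p).
  rewrite (bigD1 (Ordinal lti)) //= eqxx mul1r big1 ?addr0 // => j nej.
  rewrite (_ : i == j = false) ?mul0r //.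
  by apply: contraNF nej => /eqP e; apply/eqP/val_inj.
rewrite nth_default // big1 // => j _; rewrite (_ : i == j = false) ?mul0r //.
by apply/negP => /eqP e; move: (ltn_ord j); rewrite -e ltnNge lei.
Qed.

Lemma fps_of_polyfps_inj : injective fps_of_polyfps.
Proof.
move=> p q e; apply/polyP => i; apply/fpsP => n.
by rewrite -!coef_fps_of_polyfps e.
Qed.

(** Uniqueness in Weierstrass division by a series N = x^a + O(t), where
    F = 1 + O(t): modulo t, the two sides are x^a Z and r, so that they have
    degree less than a only if they vanish; one proceeds with the next power
    of t. *)
Lemma weierstrass_unique (a : nat) (N Z r F : {fps {poly B}}) :
    coefs N 0 = 'X^a -> coefs F 0 = 1 ->
    (forall n, size (coefs r n) <= a)%N -> N * Z = r * F ->
  Z = 0 /\ r = 0.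
Proof.
move=> N0 F0 szr eNZ.
suffices H n : coefs Z n = 0 /\ coefs r n = 0.
  by split; apply/fpsP => n; case: (H n).
elim/ltn_ind: n => n IHn.
have := congr1 (fun H => coefs H n) eNZ; rewrite [r * F]mulrC !coefsM /=.
rewrite !big_ord_recl /= !subn0 N0 F0 mul1r.
have lt_n (i : 'I_n) : (n - bump 0 i < n)%N.
  by rewrite ltn_subrL /=; apply: leq_ltn_trans (ltn_ord i).
rewrite !big1 ?addr0 => [e|i _|i _].
- suffices Z0 : coefs Z n = 0 by rewrite -e Z0 mulr0.
  apply/eqP/negPn/negP => nzZ; have := szr n.
  rewrite -e size_monicM ?monicXn // size_polyXn addSn /= leqNgt => /negP; apply.
  by rewrite -{1}[a]addn0 ltn_add2l size_poly_gt0.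
- by have [_ ->] := IHn _ (lt_n i); rewrite mulr0.
- by have [-> _] := IHn _ (lt_n i); rewrite mulr0.
Qed.

Variables (a : nat) (W : {poly B}) (F : nat -> {poly B}).
Hypotheses (F0 : F 0 = 1) (FS : forall n, F n.+1 = drop_poly a (W * F n)).

(* The same polynomial x^a - t W(x), with coefficients in B[[t]] for K, and in
   B[x][t] for K0. *)
Let K : {poly {fps B}} := 'X^a - map_poly (fun w => fps_of_poly 'X * fpsC w) W.
Let K0 : {poly {poly {poly B}}} := 'X^a - map_poly (fun w => 'X * w%:P%:P) W.
Let P : {poly {fps B}} :=
  \poly_(i < a) Fps (fun n => if n is m.+1 then (W * F m)`_i else 0).
Let N : {poly {fps B}} := 'X^a - P.
Let f := @fps_of_poly {poly B}.

Let fpsK : fps_of_polyfps K = fpsC 'X^a - f 'X * fpsC W.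
Proof.
apply/fpsP => n; apply/polyP => i.
rewrite coef_fps_of_polyfps /K coefB coefsD coefsN coefXn coef_map_id0; last first.
  by rewrite /fpsC !rmorph0 mulr0.
rewrite coefsD coefsN coefB coefs_fpsC !coefsXM.
case: n => [|n]; rewrite ?coefs_fpsC /= coef0.
  by rewrite !subr0 coefXn; case: (i == a).
by congr (_ - _); [case: (i == a) | case: (n == 0%N); rewrite ?coef0].
Qed.

Let coefs_fpsN n :
  coefs (fps_of_polyfps N) n =
  if n is m.+1 then - take_poly a (W * F m) else 'X^a.
Proof.
apply/polyP => i; rewrite coef_fps_of_polyfps /N coefB coefsD coefsN coefXn.
rewrite coef_poly; case: n => [|n] /=.
  by rewrite coefXn; case: ifP; rewrite ?subr0 //; case: (i == a).
rewrite coefN coef_take_poly.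
by case: (i == a); case: ifP => //=; rewrite ?sub0r.
Qed.

Let functional_equation : fps_of_polyfps K * Fps F = fps_of_polyfps N.
Proof.
rewrite fpsK mulrBl -mulrA; apply/fpsP => n.
case: n => [|n]; rewrite coefsD coefsN coefsXM coefsCM coefs_fpsN.
  by rewrite /= F0 mulr1 subr0.
rewrite coefsCM /= FS -{2}(poly_take_drop a (W * F n)) mulrC.
by rewrite opprD addrCA subrr addr0.
Qed.

Let N_monic : N \is monic /\ size N = a.+1.
Proof.
have sz : (size (- P) < size ('X^a : {poly {fps B}}))%N.
  by rewrite size_polyN size_polyXn ltnS size_poly.
split; last by rewrite /N size_polyDl // size_polyXn.
by rewrite monicE /N lead_coefDl // lead_coefXn.
Qed.

(** The functional equation K F = N has N monic of degree a in x. Dividing K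
    by N in B[[t]][x] leaves no remainder, by uniqueness of Weierstrass
    division, so that N is a factor of the polynomial K; its coefficients are
    thus algebraic, and so is F = N / K. *)
Theorem walk_series_algebraic : algebraic_series (Fps F).
Proof.
have [monN szN] := N_monic.
have nzN : N != 0 by apply: monic_neq0.
have eK := Pdiv.IdomainMonic.divp_eq monN K.
have sz_r n : (size (coefs (fps_of_polyfps (K %% N)%R) n) <= a)%N.
  apply/leq_sizeP => i lei; rewrite coef_fps_of_polyfps nth_default //.
  by apply: leq_trans lei; rewrite -ltnS -szN ltn_modp.
have [|||_ r0] := @weierstrass_unique a (fps_of_polyfps N)
    (1 - fps_of_polyfps (K %/ N) * Fps F) _ (Fps F) _ _ sz_r.
- by rewrite coefs_fpsN.
- by rewrite /= F0.
- rewrite mulrBr mulr1 -{1}functional_equation {1}eK rmorphD rmorphM /=.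
  by rewrite mulrDl mulrA [fps_of_polyfps N * _]mulrC addrAC subrr add0r.
have {}r0 : (K %% N)%R = 0 by apply: fps_of_polyfps_inj; rewrite r0 rmorph0.
pose C : {rmorphism {fps B} -> {fps {poly B}}} := fps_map polyC.
have eCK : map_poly f K0 = map_poly C K.
  rewrite /K0 /K !rmorphB /= !map_polyXn; congr (_ - _).
  rewrite -!map_poly_comp_id0 ?polyC0 ?mulr0 ?rmorph0 ?mulr0 //.
  apply: eq_map_poly => w /=; rewrite !rmorphM /= /fpsC.
  by rewrite !fps_map_of_poly /= map_polyX map_polyC.
have nzK : fps_of_polyfps K != 0.
  apply/eqP => /(congr1 (fun H => coefs (H * Fps F) 0)).
  rewrite functional_equation coefs_fpsN mul0r => /eqP.
  by rewrite -size_poly_eq0 size_polyXn.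
have algN i : algebraic_elt f (C N`_i).
  rewrite -coef_map.
  apply: (@algebraic_monic_factor _ _ _ K0 _ (map_poly C (K %/ N))).
  - exact: fps_of_poly_inj.
  - apply: contraNneq nzK => K00; rewrite -(rmorph0 fps_of_polyfps).
    rewrite (inj_eq fps_of_polyfps_inj).
    have injC : injective C by apply: fps_map_inj; apply: polyC_inj.
    by rewrite -(inj_eq (map_poly_inj_morph injC)) -eCK K00 !rmorph0.
  - exact: monic_map.
  - by rewrite eCK {1}eK r0 addr0 mulrC rmorphM.
apply: (algebraic_dom_div (@fps_of_poly_inj _) nzK functional_equation).
  rewrite fpsK /fpsC -rmorphM -rmorphB.
  exact: (algebraic_dom_id (@fps_of_poly_inj _)).
rewrite fps_of_polyfpsE; apply: (algebraic_dom_sum (@fps_of_poly_inj _)) => i.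
apply: (algebraic_domM (@fps_of_poly_inj _)); first exact: algN.
exact: (algebraic_dom_id (@fps_of_poly_inj _) ('X^i)%:P).
Qed.
End PolyFps.

(** * Linear algebra over an integral domain *)

(** A nonzero vector in the kernel exists over the field of fractions, and its
    denominators can be cleared. *)
Lemma dependent_rows (A : idomainType) (I J : finType) (M : I -> J -> A) :
    (#|J| < #|I|)%N ->
  exists2 c : I -> A, exists i, c i != 0 &
    forall j, \sum_i c i * M i j = 0.
Proof.
move=> ltJI; pose X : 'M[{fraction A}]_(#|I|, #|J|) :=
  \matrix_(i, j) (M (enum_val i) (enum_val j))%:F.
have : kermx X != 0.
  rewrite kermx_eq0 /row_free neq_ltn.
  by rewrite (leq_ltn_trans (rank_leq_col _) ltJI).
case/rowV0Pn => v /sub_kermxP vX0 nzv.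
have [d nzd [p defp]] := clear_denominators (rVpoly v).
have cE (i : 'I_#|I|) : (p`_i)%:F = d%:F * v 0 i.
  have := congr1 (fun r : {poly _} => r`_i) defp.
  by rewrite coef_map coefZ coef_rVpoly_ord => /esym.
exists (fun i => p`_(enum_rank i)).
  have /rV0Pn[i nzvi] := nzv; exists (enum_val i); rewrite enum_valK.
  by rewrite -tofrac_eq0 cE mulf_neq0 // tofrac_eq0.
move=> j; apply/eqP; rewrite -tofrac_eq0 rmorph_sum /=; apply/eqP.
have := congr1 (fun Y : 'rV_#|J| => Y 0 (enum_rank j)) vX0; rewrite !mxE => e.
rewrite (reindex _ (onW_bij _ (enum_val_bij I))) /=.
transitivity (d%:F * \sum_i v 0 i * X i (enum_rank j)); last by rewrite e mulr0.
rewrite mulr_sumr; apply: eq_bigr => i _.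
by rewrite enum_valK tofracM cE mxE enum_rankK mulrA.
Qed.

(** * Derivations of series in two variables *)

Section Bivariate.
Variable A : idomainType.
Local Notation E := {fps {fps A}}.
Local Notation Rg := {poly {poly A}}.
Implicit Types (z : E) (w : nat -> nat -> A).

Definition coef2 z n i : A := coefs (coefs z n) i.

Lemma coef2P z z' : (forall n i, coef2 z n i = coef2 z' n i) -> z = z'.
Proof. by move=> e; apply/fpsP => n; apply/fpsP => i; apply: e. Qed.

Lemma coef2D z z' n i : coef2 (z + z') n i = coef2 z n i + coef2 z' n i.
Proof. by []. Qed.

Lemma coef2M z z' n i : coef2 (z * z') n i =
  \sum_(j < n.+1) \sum_(k < i.+1) coef2 z j k * coef2 z' (n - j) (i - k).
Proof. by rewrite /coef2 coefsM coefs_sum. Qed.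

Lemma coef2_sum (I : Type) (r : seq I) (P : pred I) (F : I -> E) n i :
  coef2 (\sum_(k <- r | P k) F k) n i = \sum_(k <- r | P k) coef2 (F k) n i.
Proof. by rewrite /coef2 !coefs_sum. Qed.

Definition scale_coefs w z : E :=
  Fps (fun n => Fps (fun i => w n i * coef2 z n i)).

Lemma coef2_scale w z n i : coef2 (scale_coefs w z) n i = w n i * coef2 z n i.
Proof. by []. Qed.

(** With t the outer variable and u the inner one, this is the derivation
    a t d/dt + b u d/du. *)
Definition euler (a b : A) : E -> E :=
  scale_coefs (fun n i => a * n%:R + b * i%:R).

Fact euler_is_zmod_morphism a b : zmod_morphism (euler a b).
Proof. by move=> z z'; apply: coef2P => n i; rewrite /coef2 /= -mulrBr. Qed.
HB.instance Definition _ a b :=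
  GRing.isZmodMorphism.Build E E (euler a b) (euler_is_zmod_morphism a b).

Lemma eulerM a b z z' : euler a b (z * z') = euler a b z * z' + z * euler a b z'.
Proof.
apply: coef2P => n i; rewrite coef2D coef2_scale !coef2M mulr_sumr -big_split /=.
apply: eq_bigr => j _; rewrite mulr_sumr -big_split /=.
apply: eq_bigr => k _; rewrite !coef2_scale -mulrA [coef2 z _ _ * (_ * _)]mulrCA.
rewrite -mulrDl; congr (_ * _); rewrite addrACA -!mulrDr -!natrD.
by rewrite !subnKC // -ltnS.
Qed.

Lemma euler1 a b : euler a b 1 = 0.
Proof.
have := eulerM a b 1 1; rewrite !mul1r mulr1 => /eqP.
by rewrite -subr_eq subrr => /eqP<-.
Qed.

Lemma eulerXS a b z n : euler a b (z ^+ n.+1) = n.+1%:R * z ^+ n * euler a b z.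
Proof.
elim: n => [|n IHn]; first by rewrite expr1 expr0 !mul1r.
rewrite exprS eulerM IHn [in RHS]mulrSr exprS; ring.
Qed.

(** * Polynomials among the bivariate series *)

Definition poly_series : Rg -> E := fps_map (@fps_of_poly A) \o @fps_of_poly _.
HB.instance Definition _ := GRing.RMorphism.on poly_series.

Lemma coef2_poly_series (p : Rg) n i : coef2 (poly_series p) n i = p`_n`_i.
Proof. by []. Qed.

Lemma poly_series_inj : injective poly_series.
Proof. by apply: inj_comp; [apply: fps_map_inj|]; apply: fps_of_poly_inj. Qed.

Lemma poly_series_eq0 p : (poly_series p == 0) = (p == 0).
Proof. by rewrite -(rmorph0 poly_series) (inj_eq poly_series_inj). Qed.

Definition euler_poly (a b : A) (p : Rg) : Rg :=
  \poly_(n < size p) \poly_(i < size p`_n) ((a * n%:R + b * i%:R) * p`_n`_i).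

Lemma euler_polyE a b p : poly_series (euler_poly a b p) = euler a b (poly_series p).
Proof.
apply: coef2P => n i; rewrite coef2_scale !coef2_poly_series coef_poly.
case: ltnP => [_|len]; last by rewrite [p`_n]nth_default ?coef0 ?mulr0.
by rewrite coef_poly; case: ltnP => // lei; rewrite [_`_i]nth_default ?mulr0.
Qed.

(** The chain rule for P(D): differentiating the coefficients of P gives P'. *)
Lemma euler_poly_horner a b (D : E) (P : {poly Rg}) : exists P' : {poly Rg},
  euler a b (map_poly poly_series P).[D] =
  (map_poly poly_series P').[D] + (map_poly poly_series P^`()).[D] * euler a b D.
Proof.
elim/poly_ind: P => [|P c [P' IHP]].
  by exists 0; rewrite deriv0 !rmorph0 !horner0 !raddf0 mul0r addr0.
exists (P' * 'X + (euler_poly a b c)%:P).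
rewrite derivMXaddC !rmorphD !rmorphM /= !map_polyX !map_polyC /= !hornerE.
rewrite [euler a b (_ + _)]raddfD /= eulerM IHP euler_polyE; ring.
Qed.

(** The polynomials of degree at most e in each of the two variables. *)
Definition degree_le (e : nat) z : Prop :=
  forall n i, (e < n)%N || (e < i)%N -> coef2 z n i = 0.

Lemma degree_le_mono e e' z : (e <= e')%N -> degree_le e z -> degree_le e' z.
Proof.
move=> lee dz n i /orP[lt|lt]; apply: dz; rewrite (leq_ltn_trans lee lt) //.
by rewrite orbT.
Qed.

Lemma degree_le_poly (p : Rg) : exists e, degree_le e (poly_series p).
Proof.
exists (maxn (size p) (\max_(n < size p) size (p`_n)%R)) => n i.
rewrite coef2_poly_series !gtn_max => /orP[] /andP[lt1 lt2].
  by rewrite [p`_n]nth_default ?coef0 // ltnW.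
have [lt_n|le_n] := ltnP n (size p); last by rewrite [p`_n]nth_default ?coef0.
rewrite [_`_i]nth_default //; apply: leq_trans (ltnW lt2).
exact: (leq_bigmax (Ordinal lt_n)).
Qed.

Lemma degree_leD e z z' : degree_le e z -> degree_le e z' -> degree_le e (z + z').
Proof. by move=> dz dz' n i lt; rewrite coef2D dz ?dz' ?addr0. Qed.

Lemma degree_leN e z : degree_le e z -> degree_le e (- z).
Proof. by move=> dz n i lt; rewrite /coef2 /= -/(coef2 _ _ _) dz ?oppr0. Qed.

Lemma degree_le_sum e (I : finType) (F : I -> E) :
  (forall i, degree_le e (F i)) -> degree_le e (\sum_i F i).
Proof.
by move=> dF n i lt; rewrite coef2_sum big1 // => k _; apply: dF.
Qed.

Lemma degree_leMn e z k : degree_le e z -> degree_le e (z *+ k).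
Proof.
move=> dz; rewrite -[k]card_ord -sumr_const; exact: degree_le_sum.
Qed.

Lemma degree_le_scale w e z : degree_le e z -> degree_le e (scale_coefs w z).
Proof. by move=> dz n i lt; rewrite coef2_scale dz ?mulr0. Qed.

Lemma degree_leM e e' z z' :
  degree_le e z -> degree_le e' z' -> degree_le (e + e') (z * z').
Proof.
move=> dz dz' n i lt; rewrite coef2M big1 // => j _; rewrite big1 // => k _.
have [ltj|lej] := boolP ((e < j) || (e < k))%N; first by rewrite dz ?mul0r.
rewrite dz' ?mulr0 //; move: lej; rewrite negb_or -!leqNgt => /andP[lej lek].
have lt_sub k1 k2 : (k1 <= e)%N -> (e + e' < k2)%N -> (e' < k2 - k1)%N.
  by move=> le_k1; rewrite ltn_subRL; apply: leq_ltn_trans; rewrite leq_add2r.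
by case/orP: lt => lt; rewrite (lt_sub _ _ _ lt) ?orbT.
Qed.

End Bivariate.

(** * Derivatives of an algebraic series *)

Section AlgebraicDerivatives.
Variable A : idomainType.
Hypothesis charA0 : forall n, n.+1%:R != 0 :> A.
Local Notation E := {fps {fps A}}.
Local Notation Rg := {poly {poly A}}.
Local Notation iota := (@poly_series A).
Variables (D : E).
Local Notation ev P := (map_poly iota P).[D].

Lemma minimal_annihilator : algebraic_elt iota D ->
  exists P : {poly Rg}, [/\ P != 0, ev P = 0 &
    forall G : {poly Rg}, G != 0 -> (size G < size P)%N -> ev G != 0].
Proof.
case=> P0 nzP0 /rootP P0D.
pose ann n := `[< exists P : {poly Rg}, [/\ P != 0, ev P = 0 & size P = n] >].
have exn : exists n, ann n by exists (size P0); apply/asboolP; exists P0.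
case: (ex_minnP exn) => n /asboolP[P [nzP PD szP]] minn; exists P; split=> //.
move=> G nzG; rewrite ltnNge szP; apply: contraNneq => GD.
by apply: minn; apply/asboolP; exists G.
Qed.

Variable P : {poly Rg}.
Hypotheses (nzP : P != 0) (PD : ev P = 0).
Hypothesis minP :
  forall G : {poly Rg}, G != 0 -> (size G < size P)%N -> ev G != 0.

Let szP_gt1 : (1 < size P)%N.
Proof.
rewrite ltnNge; apply: contraNN nzP => /size1_polyC eP; move: PD.
rewrite eP map_polyC hornerC /= => /eqP; rewrite poly_series_eq0 => /eqP->.
by rewrite polyC0 eqxx.
Qed.

Let nzP' : P^`() != 0.
Proof.
apply/eqP => /(congr1 (fun G : {poly Rg} => G`_(size P).-2)).
rewrite coef_deriv coef0 prednK; last by rewrite -subn1 subn_gt0.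
have nz : (size P).-1%:R != 0 :> Rg.
  rewrite -(rmorph_nat polyC) polyC_eq0 -(rmorph_nat polyC) polyC_eq0.
  by case: (size P) szP_gt1 => [|[|k]] //= _; apply: charA0.
move/eqP; rewrite -mulr_natr mulf_eq0 (negPf nz) orbF.
by rewrite -lead_coefE lead_coef_eq0 (negPf nzP).
Qed.

(** The derivative of P is coprime to P: in a factorization of P, up to a scalar,
    as k times the gcd, one of the factors vanishes at D, and by minimality it
    has the degree of P; since the gcd divides P', this factor is k. A Bezout
    relation evaluated at D then inverts P'(D), up to the factor r. *)
Lemma annihilator_separable : exists2 r : Rg, r != 0 &
  exists G : {poly Rg}, ev G * ev P^`() = iota r.
Proof.
have cop : coprimep P P^`().
  have /Pdiv.Idomain.dvdpP[[c k] /= nzc eP] := dvdp_gcdl P P^`().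
  have nzg : gcdp P P^`() != 0 by rewrite gcdp_eq0 (negPf nzP).
  have nzk : k != 0.
    apply: contraNneq nzc => k0; move/eqP: eP.
    by rewrite k0 mul0r scale_poly_eq0 (negPf nzP) orbF.
  have ltgP : (size (gcdp P P^`()) < size P)%N.
    apply: leq_ltn_trans (leq_gcdpr _ nzP') _.
    by apply: lt_size_deriv.
  rewrite /coprimep eqn_leq size_poly_gt0 nzg andbT leqNgt; apply/negP => gtg1.
  have szPk : size P = (size k + size (gcdp P P^`())).-1.
    by rewrite -(size_scale P nzc) eP size_mul.
  have ltkP : (size k < size P)%N.
    move: gtg1; rewrite szPk; case: (size (gcdp _ _)) => [|[|m]] // _.
    by rewrite !addnS /= ltnS leq_addr.
  have := congr1 (fun G : {poly Rg} => ev G) eP; rewrite map_polyZ hornerZ PD mulr0.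
  rewrite rmorphM hornerM => /esym/eqP; rewrite mulf_eq0.
  by rewrite (negPf (minP nzk ltkP)) (negPf (minP nzg ltgP)).
have [[u v] /= uv1] := Bezout_coprimepP _ _ cop.
have /eqP := eqp_size uv1; rewrite size_poly1 => /size_poly1P[r nzr defr].
exists r => //; exists v.
have := congr1 (fun G : {poly Rg} => ev G) defr.
by rewrite rmorphD !rmorphM /= hornerD !hornerM PD mulr0 add0r map_polyC hornerC.
Qed.

(* The span of the powers of D over the rational functions, with a bound on the
   exponents that pseudo-division by P achieves. *)
Let fin_span (z : E) : Prop := exists2 q : Rg, q != 0 &
  exists2 G : {poly Rg}, (size G <= size P)%N & iota q * z = ev G.

Let fin_span_div (r : Rg) (G : {poly Rg}) z :
  r != 0 -> iota r * z = ev G -> fin_span z.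
Proof.
move=> nzr rz; exists (lead_coef P ^+ scalp G P * r).
  by rewrite mulf_neq0 // expf_neq0 // lead_coef_eq0.
exists (G %% P); first by rewrite ltnW // ltn_modp.
have := congr1 (fun G : {poly Rg} => ev G) (Pdiv.Idomain.divp_eq G P).
rewrite map_polyZ hornerZ rmorphD rmorphM /= hornerD hornerM PD mulr0 add0r => <-.
by rewrite -rz mulrA rmorphM.
Qed.

Let evM G H : ev (G * H) = ev G * ev H.
Proof. by rewrite rmorphM hornerM. Qed.

(** Differentiating P(D) = 0 gives P'(D) times the derivative of D as a
    polynomial in D, and P'(D) is invertible. *)
Lemma euler_power_fin_span a b i : fin_span (euler a b (D ^+ i)).
Proof.
have [r nzr [V eV]] := annihilator_separable.
have [P1 eP1] := euler_poly_horner a b D P.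
have eD : ev P^`() * euler a b D = - ev P1.
  by apply/eqP; rewrite -addr_eq0 addrC -eP1 PD raddf0.
case: i => [|i].
  apply: (@fin_span_div 1 0); rewrite ?oner_eq0 //.
  by rewrite expr0 euler1 mulr0 rmorph0 horner0.
have eX : ev ('X^i *+ i.+1) = D ^+ i *+ i.+1.
  by rewrite raddfMn /= map_polyXn hornerMn hornerXn.
have eG : ev (- (V * P1)) = iota r * euler a b D.
  by rewrite raddfN hornerN evM -mulrN -eD mulrA eV.
apply: (@fin_span_div r ('X^i *+ i.+1 * - (V * P1))) => //.
rewrite evM eX eG eulerXS.
by rewrite mulr_natl mulrCA.
Qed.

(** The powers D^i, for i at most the degree of P, span a space stable under
    derivation, with a common denominator q. The boolean selects one of two
    derivations, t d/dt if it is false and u d/du - t d/dt if it is true. *)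
Lemma differential_family : exists m, exists b : 'I_m -> E, exists i0 : 'I_m,
  exists q : E, exists C : nat, exists d : bool -> 'I_m -> 'I_m -> E,
  [/\ b i0 = D, q != 0, degree_le C q, forall s i j, degree_le C (d s i j) &
    forall s i, q * euler (if s then -1 else 1) s%:R (b i) =
                \sum_j d s i j * b j].
Proof.
pose m := size P; pose b (i : 'I_m) := D ^+ i.
pose I := (bool * 'I_m)%type.
pose dlt (k : I) := euler (if k.1 then -1 else 1) (k.1)%:R (b k.2).
have /choice[qG qGP] (k : I) : exists qG : Rg * {poly Rg},
    [/\ qG.1 != 0, (size qG.2 <= m)%N & iota qG.1 * dlt k = ev qG.2].
  have [q nzq [G szG eG]] := euler_power_fin_span (if k.1 then -1 else 1) (k.1)%:R k.2.
  by exists (q, G).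
pose q := \prod_k (qG k).1.
pose c k (j : 'I_m) := (\prod_(l | l != k) (qG l).1) * (qG k).2`_j.
(* None indexes the degree of q, and Some those of the coefficients. *)
have /choice[e deg_e] (x : option (I * 'I_m)) :
    exists e, degree_le e (if x is Some kj then iota (c kj.1 kj.2) else iota q).
  by case: x => [kj|]; apply: degree_le_poly.
exists m, b, (Ordinal szP_gt1), (iota q), (\max_x e x).
exists (fun s i j => iota (c (s, i) j)); split=> //.
- by rewrite poly_series_eq0; apply/prodf_neq0 => k _; case: (qGP k).
- exact: degree_le_mono (leq_bigmax None) (deg_e None).
- move=> s i j.
  exact: degree_le_mono (leq_bigmax (Some ((s, i), j))) (deg_e (Some ((s, i), j))).
move=> s i; have [_ sz e_k] := qGP (s, i).
rewrite /q (bigD1 (s, i)) //= rmorphM mulrAC e_k.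
rewrite (horner_coef_wide _ (leq_trans (size_poly _ _) sz)) mulr_suml.
by apply: eq_bigr => j _; rewrite coef_map /= /c rmorphM mulrC mulrA.
Qed.
End AlgebraicDerivatives.

(** * Diagonals of algebraic series *)

Lemma coefsXnM (R : comNzRingType) k (F : {fps R}) n :
  coefs (fps_of_poly 'X ^+ k * F) n = if (k <= n)%N then coefs F (n - k) else 0.
Proof.
elim: k n => [|k IHk] n; first by rewrite expr0 mul1r subn0.
by rewrite exprS -mulrA coefsXM; case: n => [|n] //; rewrite IHk ltnS subSS.
Qed.

Lemma coefs_iter_deriv (R : comNzRingType) k (F : {fps R}) n :
  coefs (iter k (@fps_deriv R) F) n = coefs F (n + k) *+ (n + k) ^_ k.
Proof.
elim: k n => [|k IHk] n; first by rewrite addn0.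
rewrite iterS /= IHk -mulrnA addSnnS ffactnSr; congr (_ *+ (_ * _)).
by rewrite -addSnnS addnK.
Qed.

Section FiltrationCounting.
Variable A : idomainType.
Local Notation E := {fps {fps A}}.

Definition cst (c : A) : E := fpsC (fpsC c).

Lemma coef2_cstM c z n i : coef2 (cst c * z) n i = c * coef2 z n i.
Proof. by rewrite /coef2 !coefsCM. Qed.

Definition mono (a k : nat) : E := fps_of_poly 'X ^+ a * fpsC (fps_of_poly 'X ^+ k).

Lemma coef2_monoM a k z n i : coef2 (mono a k * z) n i =
  if (a <= n)%N && (k <= i)%N then coef2 z (n - a) (i - k) else 0.
Proof.
rewrite /coef2 /mono -mulrA coefsXnM; case: (a <= n)%N => //.
by rewrite coefsCM coefsXnM.
Qed.

Lemma degree_le_mono_series a k : degree_le (a + k) (mono a k).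
Proof.
move=> n i lt; rewrite -[mono a k]mulr1 coef2_monoM; case: ifP => // /andP[lea lek].
rewrite /coef2 coefs1; have [eqn|//] := eqVneq (n - a)%N 0%N.
rewrite coefs1; have [eqi|//] := eqVneq (i - k)%N 0%N.
by exfalso; lia.
Qed.

Lemma degree_le_nat k : degree_le 0 (k%:R : E).
Proof.
apply: degree_leMn; have -> : 1 = mono 0 0; last first.
  exact: (@degree_le_mono_series 0 0).
by rewrite /mono !expr0 mul1r /fpsC !rmorph1.
Qed.

Variables (m : nat) (b : 'I_m -> E) (q : E) (C : nat).
Variable (d : bool -> 'I_m -> 'I_m -> E).
Hypotheses (deg_q : degree_le C q) (deg_d : forall s i j, degree_le C (d s i j)).
Hypothesis euler_b : forall s i,
  q * euler (if s then -1 else 1) s%:R (b i) = \sum_j d s i j * b j.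

(** The series that q^n turns into a combination of the b i with coefficients of
    degree at most e: n bounds the pole order, and each derivation raises n by 1
    and e by C. *)
Definition filtration (n e : nat) (z : E) : Prop :=
  exists2 c : 'I_m -> E, forall i, degree_le e (c i) &
    q ^+ n * z = \sum_i c i * b i.

Lemma filtration_raise n n' e z : (n <= n')%N ->
  filtration n e z -> filtration n' (e + (n' - n) * C) z.
Proof.
move=> le_n [c deg_c cz]; exists (fun i => q ^+ (n' - n) * c i) => [i|].
  rewrite addnC; apply: degree_leM => //; elim: (n' - n)%N => [|k IHk].
    exact: degree_le_nat 1%N.
  by rewrite exprS mulSn; apply: degree_leM.
rewrite -{1}(subnK le_n) exprD -mulrA cz mulr_sumr.
by apply: eq_bigr => i _; rewrite mulrA.
Qed.

Lemma filtrationM n e e' x z :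
  degree_le e' x -> filtration n e z -> filtration n (e' + e) (x * z).
Proof.
move=> deg_x [c deg_c cz]; exists (fun i => x * c i) => [i|].
  exact: degree_leM.
by rewrite mulrCA cz mulr_sumr; apply: eq_bigr => i _; rewrite mulrA.
Qed.

Lemma filtration_euler s g n e z : filtration n e z ->
  filtration n.+1 (e + C) (euler (if s then -1 else 1) s%:R z + cst g * z).
Proof.
case=> c deg_c cz; set dl := euler _ _.
pose c' i := q * dl (c i) - dl q * c i *+ n + q * (cst g * c i) +
  \sum_k c k * d s k i.
exists c' => [i|].
  have deg_dl e' y : degree_le e' y -> degree_le e' (dl y) by apply: degree_le_scale.
  rewrite /c' addnC; do !apply: degree_leD.
  - by apply: degree_leM => //; apply: deg_dl.
  - by apply/degree_leN/degree_leMn/degree_leM => //; apply: deg_dl.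
  - apply: degree_leM => // x y lt; rewrite coef2_cstM.
    by rewrite (deg_c i) ?mulr0.
  - by apply: degree_le_sum => k; rewrite addnC; apply: degree_leM.
have qn : q * dl (q ^+ n) = dl q * q ^+ n *+ n.
  case: (n) => [|n']; first by rewrite expr0 /dl euler1 mulr0.
  by rewrite /dl eulerXS exprS -[in RHS]mulr_natl; ring.
have dlS : \sum_i dl (c i * b i) = dl (q ^+ n * z) by rewrite cz /dl raddf_sum.
transitivity (q * (\sum_i dl (c i * b i)) - dl q * (\sum_i c i * b i) *+ n +
              q * (cst g * \sum_i c i * b i)).
  rewrite dlS -cz {2}/dl eulerM -/dl.
  rewrite [q * (dl (q ^+ n) * z + _)]mulrDr [q * (dl (q ^+ n) * z)]mulrA qn exprS.
  rewrite -(mulr_natl (dl q * q ^+ n)) -(mulr_natl (dl q * (q ^+ n * z))).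
  move: (dl z) (dl q) (q ^+ n) (cst g) (n%:R) => *; ring.
transitivity (\sum_i ((q * dl (c i) - dl q * c i *+ n + q * (cst g * c i)) * b i)
              + \sum_k c k * (q * dl (b k))).
  rewrite !mulr_sumr -sumrMnl -sumrB -!big_split /=; apply: eq_bigr => i _.
  rewrite {1}/dl eulerM -/dl.
  rewrite -(mulr_natl (dl q * (c i * b i))) -(mulr_natl (dl q * c i)).
  move: (dl _) (dl _) (dl _) (cst g) (n%:R) => *; ring.
rewrite /c'; under [RHS]eq_bigr do rewrite mulrDl; rewrite big_split /=.
congr (_ + _); under eq_bigr do rewrite /dl euler_b mulr_sumr.
rewrite exchange_big /=; apply: eq_bigr => i _; rewrite mulr_suml.
by apply: eq_bigr => k _; rewrite mulrA.
Qed.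

(** The factor by which t^n u^i is multiplied by the operator t^k (d/dt)^k
    followed by u^{l+1} delta^l u^{-1}, where delta is the derivation for which
    u has derivative 1 and tu is a constant: u delta = u d/du - t d/dt. *)
Definition lipshitz_weight (k l n i : nat) : A :=
  (n ^_ k)%:R * \prod_(h < l) (i%:R - n%:R - h.+1%:R).

Let op k l := scale_coefs (lipshitz_weight k l).

(** Each factor of the weight is a derivation plus a constant. *)
Lemma filtration_op k l z : filtration 0 0 z ->
  filtration (k + l) ((k + l) * C) (op k l z).
Proof.
move=> z_b; elim: l => [|l IHl]; last first.
  have -> : op k l.+1 z =
      euler (-1) true%:R (op k l z) + cst (- l.+1%:R) * op k l z.
    apply: coef2P => n i; rewrite coef2D coef2_cstM !coef2_scale.
    by rewrite /lipshitz_weight big_ord_recr /=; ring.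
  by rewrite addnS mulSn [(C + _)%N]addnC; exact: (filtration_euler true _ IHl).
rewrite addn0; elim: k => [|k IHk].
  suff -> : op 0 0 z = z by [].
  apply: coef2P => n i; rewrite coef2_scale /lipshitz_weight big_ord0.
  by rewrite ffactn0 mulr1 mul1r.
have -> : op k.+1 0 z = euler 1 false%:R (op k 0 z) + cst (- k%:R) * op k 0 z.
  apply: coef2P => n i; rewrite coef2D coef2_cstM !coef2_scale.
  rewrite /lipshitz_weight !big_ord0 ffactnSr natrM.
  have [lekn|ltnk] := leqP k n; first by rewrite natrB //=; ring.
  by rewrite ffact_small //=; ring.
by rewrite mulSn [(C + _)%N]addnC; exact: (filtration_euler false _ IHk).
Qed.

(** The operators are (tu)^a delta^l u^{-1} t^k (d/dt)^k, for a, k, l less than N,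
    multiplied by u^{N+1} to avoid negative powers of u. The N^3 series that they
    produce lie, after multiplication by q^{2N}, in a space of polynomial
    combinations of the b i of degree O(N), whose dimension is only O(N^2): for
    large N they are linearly dependent. *)
Lemma lipshitz_relation i0 : exists N (c : 'I_N * 'I_N * 'I_N -> A),
  (exists x, c x != 0) /\
  q ^+ (N + N) * \sum_x cst (c x) *
     (mono x.1.1 (x.1.1 + (N - x.2)) * op x.1.2 x.2 (b i0)) = 0.
Proof.
(* With this N, the dimension m (L + 1)^2 of the target, for the bound L on the
   degrees, is less than N^3, because L + 1 is at most N (2 C + 4). *)
pose N := (m * (2 * C + 4) ^ 2).+1; exists N.
pose L := ((N + N) * C + 3 * N)%N.
pose T := ('I_N * 'I_N * 'I_N)%type.
have b_filt : filtration 0 0 (b i0).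
  exists (fun i => (i == i0)%:R) => [i|].
    exact: degree_le_nat.
  rewrite expr0 mul1r (bigD1 i0) //= eqxx mul1r big1 ?addr0 // => i /negPf->.
  by rewrite mul0r.
pose z (x : T) := mono x.1.1 (x.1.1 + (N - x.2)) * op x.1.2 x.2 (b i0).
have /choice[c cP] (x : T) : exists c : 'I_m -> E,
    (forall i, degree_le L (c i)) /\ q ^+ (N + N) * z x = \sum_i c i * b i.
  have le2N : (x.1.2 + x.2 <= N + N)%N by apply: leq_add; apply: ltnW.
  have := filtrationM (@degree_le_mono_series x.1.1 (x.1.1 + (N - x.2)))
            (filtration_raise le2N (filtration_op x.1.2 x.2 b_filt)).
  case=> c deg_c cz; exists c; split=> // i; apply: degree_le_mono (deg_c i).
  have := ltn_ord x.1.1; rewrite /L -mulnDl subnKC //; lia.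
pose J := ('I_m * 'I_L.+1 * 'I_L.+1)%type.
have [|lam nz_lam lam0] := @dependent_rows A T J
    (fun x y => coef2 (c x y.1.1) y.1.2 y.2).
  rewrite !card_prod !card_ord.
  have leL : (L.+1 <= N * (2 * C + 4))%N by rewrite /L; nia.
  have : (m * L.+1 * L.+1 <= m * (2 * C + 4) ^ 2 * (N * N))%N by nia.
  move=> le_J; apply: leq_ltn_trans le_J _.
  by rewrite [X in (_ < X)%N]mulnC -mulnA -/N; nia.
exists lam; split=> //.
rewrite mulr_sumr.
under eq_bigr => x _ do rewrite mulrCA -/(z x) (proj2 (cP x)) mulr_sumr.
rewrite exchange_big big1 //= => i _; under eq_bigr do rewrite mulrA.
rewrite -mulr_suml (_ : \sum_x _ = 0) ?mul0r //.
apply: coef2P => n k; rewrite coef2_sum [RHS]/(coef2 0 n k) /=.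
have [/andP[len lek]|ngt] := boolP ((n <= L)%N && (k <= L)%N).
  rewrite -[RHS](lam0 (i, Ordinal (len : (n < L.+1)%N),
                          Ordinal (lek : (k < L.+1)%N))).
  by apply: eq_bigr => x _; rewrite coef2_cstM.
rewrite big1 // => x _; rewrite coef2_cstM (proj1 (cP x)) ?mulr0 //.
by rewrite negb_and -!ltnNge in ngt.
Qed.
End FiltrationCounting.

Lemma coefs_scaled_monoM (R : comNzRingType) (c : R) k (F : {fps R}) n :
  coefs (fps_of_poly (c *: 'X^k) * F) n =
  if (k <= n)%N then c * coefs F (n - k) else 0.
Proof.
rewrite -mul_polyC rmorphM rmorphXn -mulrA -/(fpsC c) coefsCM coefsXnM.
by case: ifP; rewrite ?mulr0.
Qed.

Section Diagonal.
Variable A : idomainType.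
Hypothesis charA0 : forall n, n.+1%:R != 0 :> A.
Local Notation E := {fps {fps A}}.

Definition diagonal (D : E) : {fps A} := Fps (fun n => coef2 D n n).

(** Let j be the least order in delta of the terms of the relation. The exponents
    i - n of the monomials t^n u^i are shifted by N - l by the term of order l. In
    the part of the relation with i - n = N - j, the terms with l = j thus come
    from the diagonal of D, where they act by operators in t and a nonzero
    factor (-1)^j j!; those with l > j come from the monomials with
    i - n = l - j, on which the product in lipshitz_weight vanishes. *)
Theorem diagonal_differential_equation (D : E) :
    algebraic_elt (@poly_series A) D ->
  exists N (p : 'I_N -> {poly A}), (exists k, p k != 0) /\
    \sum_k fps_of_poly (p k) * iter k (@fps_deriv A) (diagonal D) = 0.
Proof.
move=> algD; have [P [nzP PD minP]] := minimal_annihilator algD.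
have [m [b [i0 [q [C [d [b_i0 nzq deg_q deg_d euler_b]]]]]]] :=
  differential_family charA0 nzP PD minP.
have [N [c [[x0 nzc] /eqP]]] := lipshitz_relation deg_q deg_d euler_b i0.
rewrite b_i0 mulf_eq0 expf_eq0 (negPf nzq) andbF /= => /eqP rel.
have exj : exists j, `[< exists x, nat_of_ord x.2 = j /\ c x != 0 >].
  by exists x0.2; apply/asboolP; exists x0.
case: (ex_minnP exj) => j /asboolP[[[a1 k1] j1] [/= def_j nzc1]] minj.
have c_lt (x : 'I_N * 'I_N * 'I_N) : (x.2 < j)%N -> c x = 0.
  move=> lt; apply/eqP/negPn/negP => nz; move: lt; rewrite ltnNge => /negP; apply.
  by apply: minj; apply/asboolP; exists x.
exists N, (fun k => \sum_(a < N) c (a, k, j1) *: 'X^(a + k)); split.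
  exists k1; apply/eqP => /(congr1 (fun p : {poly A} => p`_(a1 + k1))).
  rewrite coef_sum coef0 (bigD1 a1) //= big1 ?addr0 => [|a nea].
    by rewrite coefZ coefXn eqxx mulr1; apply/eqP.
  rewrite coefZ coefXn eqn_add2r eq_sym (_ : _ == _ = false) ?mulr0 //.
  exact/negbTE.
apply/fpsP => n; rewrite coefs_sum.
(* The factor by which the terms with l = j act on the diagonal of D. *)
pose kappa : A := \prod_(h < j) - h.+1%:R.
have nz_kappa : kappa != 0.
  by apply/prodf_neq0 => h _; rewrite oppr_eq0; apply: charA0.
apply: (mulIf nz_kappa); rewrite mul0r mulr_suml.
have := congr1 (fun z => coef2 z n (n + N - j)) rel.
rewrite coef2_sum (_ : coef2 0 _ _ = 0) // => rel_n; rewrite -[RHS]rel_n.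
have ltjN : (j < N)%N by rewrite -def_j.
have {rel_n} -> : forall T : 'I_N * 'I_N * 'I_N -> A,
    \sum_x T x = \sum_k \sum_a \sum_l T (a, k, l).
  move=> T; rewrite [RHS]exchange_big !pair_bigA /=.
  by apply: eq_bigr => -[[a k] l].
apply: eq_bigr => k _.
rewrite rmorph_sum [_ * iter _ _ _]mulr_suml coefs_sum mulr_suml; apply: eq_bigr => a _.
rewrite coefs_scaled_monoM (bigD1 j1) //= big1 ?addr0 => [|l nel]; last first.
  rewrite coef2_cstM; have [ltlj|] := ltnP l j.
    by rewrite c_lt ?mul0r.
  rewrite leq_eqVlt -def_j => /orP[/eqP e|ltjl].
    by rewrite (val_inj e) eqxx in nel.
  rewrite coef2_monoM; case: ifP => [/andP[lean lei]|_]; last by rewrite mulr0.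
  rewrite coef2_scale /lipshitz_weight.
  (* The vanishing factor of the product. *)
  have lth : (l - j1 - 1 < l)%N by lia.
  rewrite (bigD1 (Ordinal lth)) //= -natrB; last by have := ltn_ord l; lia.
  have -> : (n + N - j1 - (a + (N - l)) - (n - a) = (l - j1 - 1).+1)%N.
    by have := ltn_ord l; lia.
  by rewrite subrr mul0r mulr0 mul0r mulr0.
rewrite coef2_cstM coef2_monoM def_j coefs_iter_deriv /=.
have -> : (a + (N - j) <= n + N - j)%N = (a <= n)%N by lia.
rewrite andbb; have [lean|ltna] := leqP a n; last first.
  by rewrite ifF ?mul0r ?mulr0 //; lia.
rewrite coef2_scale /lipshitz_weight.
rewrite (_ : n + N - j - (a + (N - j)) = n - a)%N; last by lia.
have -> : \prod_(h < j) ((n - a)%:R - (n - a)%:R - h.+1%:R) = kappa.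
  by apply: eq_bigr => h _; rewrite subrr sub0r.
have [leak|ltnak] := leqP (a + k) n; last first.
  by rewrite ffact_small ?mul0r ?mulr0 //; lia.
rewrite (_ : n - (a + k) + k = n - a)%N; last by lia.
by rewrite -[_ *+ _]mulr_natl; ring.
Qed.
End Diagonal.

(** * D-finite series *)

Lemma fps_derivM (R : comNzRingType) (F G : {fps R}) :
  fps_deriv (F * G) = fps_deriv F * G + F * fps_deriv G.
Proof.
apply/fpsP => n; rewrite coefsD !coefsM /=.
transitivity (\sum_(j < n.+2) (coefs F j *+ j * coefs G (n.+1 - j) +
                coefs F j * (coefs G (n.+1 - j) *+ (n.+1 - j)))).
  rewrite -sumrMnl; apply: eq_bigr => j _.
  by rewrite mulrnAl mulrnAr -mulrnDr subnKC // -ltnS.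
rewrite big_split /=; congr (_ + _).
  rewrite big_ord_recl /= mulr0n mul0r add0r; apply: eq_bigr => j _.
  by rewrite /bump /= add1n subSS.
rewrite big_ord_recr /= subnn mulr0n mulr0 addr0; apply: eq_bigr => j _.
by rewrite subSn // -ltnS.
Qed.

Lemma fps_deriv_of_poly (R : comNzRingType) (p : {poly R}) :
  fps_deriv (fps_of_poly p) = fps_of_poly p^`().
Proof. by apply/fpsP => n /=; rewrite coef_deriv. Qed.

Section DFinite.
Variables (A : idomainType) (F : {fps A}).
Local Notation dF k := (iter k (@fps_deriv A) F).

Let comb n z :=
  exists c : nat -> {poly A}, z = \sum_(k < n) fps_of_poly (c k) * dF k.

Let comb0 n : comb n 0.
Proof. by exists (fun=> 0); rewrite big1 // => k _; rewrite rmorph0 mul0r. Qed.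

Let combD n y z : comb n y -> comb n z -> comb n (y + z).
Proof.
move=> [c ->] [c' ->]; exists (fun k => c k + c' k); rewrite -big_split /=.
by apply: eq_bigr => k _; rewrite rmorphD mulrDl.
Qed.

Let comb_dF n k (p : {poly A}) : (k < n)%N -> comb n (fps_of_poly p * dF k).
Proof.
move=> ltkn; exists (fun l => if l == k then p else 0).
rewrite (bigD1 (Ordinal ltkn)) //= eqxx big1 ?addr0 // => l nel.
by rewrite ifN ?rmorph0 ?mul0r.
Qed.

Let comb_deriv n z : comb n z -> comb n.+1 (fps_deriv z).
Proof.
case=> c ->.
have -> : fps_deriv (\sum_(k < n) fps_of_poly (c k) * dF k) =
    \sum_(k < n) fps_deriv (fps_of_poly (c k) * dF k).
  by apply/fpsP => m; rewrite [LHS]/= !coefs_sum -sumrMnl.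
apply: big_ind; [exact: comb0 | exact: combD | move=> k _].
rewrite fps_derivM fps_deriv_of_poly -iterS.
by apply: combD; apply: comb_dF; [exact: ltnW (ltn_ord k) | exact: ltn_ord].
Qed.

(* The relation, solved for the derivative of highest order that occurs. *)
Let leading_coefficient N (p : 'I_N -> {poly A}) :
    (exists k, p k != 0) -> \sum_k fps_of_poly (p k) * dF k = 0 ->
  exists r, exists2 pr : {poly A}, pr != 0 & comb r (fps_of_poly pr * dF r).
Proof.
elim: N p => [|N IHN] p [k nzpk]; first by case: k nzpk => -[].
rewrite big_ord_recr /=; have [pN0|nzpN] := eqVneq (p ord_max) 0.
  rewrite pN0 rmorph0 mul0r addr0; apply: IHN.
  have [i ei|ei] := unliftP ord_max k; last by rewrite ei pN0 eqxx in nzpk.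
  exists i; rewrite (_ : widen_ord _ i = k) //; apply: val_inj.
  by rewrite ei /= /bump leqNgt ltn_ord.
move=> e; exists N, (p ord_max) => //.
exists (fun k => - p (inord k)); move/eqP: e; rewrite addrC addr_eq0 => /eqP->.
rewrite -sumrN; apply: eq_bigr => i _; rewrite rmorphN mulNr.
congr (- (fps_of_poly (p _) * _)).
by apply: val_inj; rewrite /= inordK // ltnS ltnW.
Qed.

(** A linear differential equation expresses the derivatives of order at least
    r, the order of the equation, through those of lower order: this holds at
    order r, and one differentiates the relation repeatedly. *)
Theorem D_finite_of_equation N (p : 'I_N -> {poly A}) :
    (exists k, p k != 0) -> \sum_k fps_of_poly (p k) * dF k = 0 ->
  D_finite F.
Proof.
move=> nzp rel; have [r [pr nzpr comb_r]] := leading_coefficient nzp rel.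
have comb_ge i : comb (r + i) (fps_of_poly pr * dF (r + i)).
  elim: i => [|i IHi]; first by rewrite addn0.
  have := comb_deriv IHi; rewrite fps_derivM fps_deriv_of_poly -iterS -addnS => c_i.
  have -> : fps_of_poly pr * dF (r + i.+1) =
      (fps_of_poly pr^`() * dF (r + i) + fps_of_poly pr * dF (r + i.+1)) +
      fps_of_poly (- pr^`()) * dF (r + i).
    by rewrite rmorphN mulNr addrAC subrr add0r.
  by apply: combD => //; apply: comb_dF; rewrite addnS.
pose iota := @ratfun_to_fps A; pose f k := (dF k)%:F.
pose low z :=
  exists c : 'I_r -> {fraction {poly A}}, z = \sum_(i < r) iota (c i) * f i.
have low0 : low 0.
  by exists (fun=> 0); rewrite big1 // => i _; rewrite /iota rmorph0 mul0r.
have lowD y z : low y -> low z -> low (y + z).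
  move=> [c ->] [c' ->]; exists (fun k => c k + c' k); rewrite -big_split /=.
  by apply: eq_bigr => k _; rewrite /iota rmorphD mulrDl.
have lowZ a z : low z -> low (iota a * z).
  move=> [c ->]; exists (fun k => a * c k); rewrite mulr_sumr.
  by apply: eq_bigr => k _; rewrite /iota rmorphM mulrA.
have low_f k : low (f k).
  elim/ltn_ind: k => k IHk; have [ltkr|lerk] := ltnP k r.
    exists (fun i : 'I_r => (i == Ordinal ltkr)%:R).
    rewrite (bigD1 (Ordinal ltkr)) //= eqxx /iota rmorph1 mul1r.
    by rewrite big1 ?addr0 // => i /negPf->; rewrite rmorph0 mul0r.
  have := comb_ge (k - r)%N; rewrite subnKC // => -[c e].
  have nzF : (fps_of_poly pr)%:F != 0 by rewrite tofrac_eq0 fps_of_poly_eq0.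
  have -> : f k = \sum_(l < k) iota ((c l)%:F / pr%:F) * f l.
    apply: (mulfI nzF); rewrite -tofracM e mulr_sumr rmorph_sum /=.
    apply: eq_bigr => l _; rewrite /iota ratfun_to_fps_div // tofracM.
    by rewrite mulrA [_ * (_ / _)]mulrCA divff // mulr1.
  by apply: big_ind => // l _; apply/lowZ/IHk.
exists r, (fun i => f i) => z; split=> [[n [c ->]]|[c ->]]; last by exists r, c.
rewrite -/(low _); apply: (big_ind low) => // i _; exact/lowZ/low_f.
Qed.
End DFinite.

(** * Walks, one step at a time *)

Section WalkRecurrence.
Variables (G : zmodType) (inside : pred G) (A : finType) (step : A -> G).
Local Notation endpt := (endpoint step).

Lemma endpoint_rcons w a : endpt (rcons w a) = endpt w + step a.
Proof. by rewrite /endpoint big_rcons /= addrC. Qed.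

Lemma confined_rcons w a :
  confined inside step (rcons w a) =
  confined inside step w && inside (endpt w + step a).
Proof.
rewrite /confined size_rcons -(addn1 (size w).+1) iotaD all_cat all_seq1 add0n.
rewrite [take (size w).+1 _]take_oversize ?size_rcons // endpoint_rcons.
congr (_ && _).
apply: eq_in_all => k; rewrite mem_iota /= add0n ltnS => lek.
by rewrite -cats1 takel_cat.
Qed.

Lemma inside_endpoint n w : w \in walks inside step n -> inside (endpt w).
Proof.
rewrite inE => /allP/(_ n); rewrite size_tuple mem_iota ltnSn => /(_ isT).
by rewrite take_oversize ?size_tuple.
Qed.

Lemma sum_walks0 (V : nmodType) (f : seq A -> V) :
  inside 0 -> \sum_(w in walks inside step 0) f w = f [::].
Proof.
move=> in0; rewrite (big_pred1 [tuple]) // => w.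
rewrite [RHS](introT eqP (tuple0 w)) inE (tuple0 w).
by rewrite /confined /= /endpoint big_nil in0.
Qed.

Lemma sum_walksS (V : nmodType) n (f : seq A -> V) :
  \sum_(w in walks inside step n.+1) f w =
  \sum_(w in walks inside step n) \sum_a
    if inside (endpt w + step a) then f (rcons w a) else 0.
Proof.
pose snoc (wa : n.-tuple A * A) := [tuple of rcons wa.1 wa.2].
have bij_snoc : bijective snoc.
  apply: inj_card_bij => [[w a] [w' a'] /(congr1 val) /= /rcons_inj[e ->]|].
    by congr (_, _); apply: val_inj.
  by rewrite card_prod !card_tuple expnSr.
rewrite (reindex snoc (onW_bij _ bij_snoc)) /=.
rewrite [RHS]big_mkcond /= [LHS]big_mkcond /=.
transitivity (\sum_(w : n.-tuple A) \sum_a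
  if w \in walks inside step n then
    if inside (endpt w + step a) then f (rcons w a) else 0 else 0).
  rewrite pair_bigA /=; apply: eq_bigr => -[w a] _ /=.
  rewrite !inE /= confined_rcons; by case: (confined _ _ w).
by apply: eq_bigr => w _; case: ifP => // _; rewrite big1.
Qed.
End WalkRecurrence.

Lemma nonneg_shift (I : finType) (f : I -> int) :
  exists a : nat, forall i, 0 <= f i + a%:Z.
Proof.
exists (\sum_i `|f i|)%N => i; rewrite (bigD1 i) //=.
by move: (\sum_(j | _) _)%N => s; lia.
Qed.

(** Shifting by a and discarding the powers less than a amounts to keeping the
    nonnegative powers of a Laurent polynomial. *)
Lemma drop_poly_shift (R : nzRingType) (a : nat) (e s : int) :
    0 <= e -> 0 <= s + a%:Z ->
  drop_poly a ('X^(`|(s + a%:Z)%R|%N + `|e|%N)) =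
  if 0 <= e + s then 'X^`|(e + s)%R|%N else 0 :> {poly R}.
Proof.
move=> e0 sa0; case: ifP => es0.
  have -> : (`|(s + a%:Z)%R| + `|e| = `|(e + s)%R| + a)%N by lia.
  by rewrite exprD drop_polyMXn_id.
by apply: drop_poly_eq0; rewrite size_polyXn; lia.
Qed.

Section WeightedWalks.
Variables (B : idomainType) (A : finType) (step : A -> int) (wt : A -> B).

Definition walk_monomial (w : seq A) : {poly B} :=
  (\prod_(a <- w) wt a) *: 'X^`|endpoint step w|%N.

Definition weighted_walks n : {poly B} :=
  \sum_(w in walks in_N step n) walk_monomial w.

(** Appending a step multiplies by the step polynomial and discards the
    negative powers, which is the recurrence of walk_series_algebraic. *)
Lemma weighted_walks_algebraic : algebraic_series (Fps weighted_walks).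
Proof.
have [a a_ge] := nonneg_shift step.
apply: (@walk_series_algebraic _ a (\sum_i wt i *: 'X^`|(step i + a%:Z)%R|%N)).
  rewrite /weighted_walks sum_walks0 //.
  by rewrite /walk_monomial big_nil /endpoint big_nil scale1r expr0.
move=> n; rewrite /weighted_walks sum_walksS mulr_sumr drop_poly_sum.
apply: eq_bigr => w /inside_endpoint in_w.
rewrite mulr_suml drop_poly_sum; apply: eq_bigr => i _.
rewrite -scalerAl -scalerAr scalerA drop_polyZ -exprD drop_poly_shift //.
rewrite /walk_monomial endpoint_rcons big_rcons /= mulrC /in_N.
by case: ifP; rewrite ?scaler0.
Qed.
End WeightedWalks.


(** * Quadrant walks of a Hadamard model *)

Section HadamardModel.
Variables (S : {fset int * int}) (U V T : {fset int}).
Hypothesis hadamardS :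
  step_poly S = gen_poly varx U + gen_poly varx V * gen_poly vary T.

Local Notation step2 := (fun s : S => val s).
Local Notation stepT := (fun s : T => val s).
Local Notation uv_step := (@union_step U V).

Variables a b : nat.
Hypotheses (S_x : forall s : S, 0 <= (val s).1 + a%:Z)
  (S_y : forall s : S, 0 <= (val s).2 + b%:Z)
  (U_x : forall u : U, 0 <= val u + a%:Z) (V_x : forall v : V, 0 <= val v + a%:Z)
  (T_y : forall s : T, 0 <= val s + b%:Z).

Let shiftx (U' : {fset int}) : Qyx := \sum_(u : U') 'X^`|(val u + a%:Z)%R|%N.
Let shifty : {poly rat} := \sum_(s : T) 'X^`|(val s + b%:Z)%R|%N.
Let shiftxy : Qyx :=
  \sum_(s : S) 'X^`|((val s).1 + a%:Z)%R|%N * ('X^`|((val s).2 + b%:Z)%R|%N)%:P.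

Lemma tofrac_shift (X : Qyx) (s : int) (k : nat) : X != 0 -> 0 <= s + k%:Z ->
  FracField.tofrac (X ^+ `|(s + k%:Z)%R|%N) =
  FracField.tofrac X ^ s * FracField.tofrac X ^+ k.
Proof.
move=> nzX ge0; rewrite -[_ ^+ k]/(_ ^ k%:Z) -expfzDr ?tofrac_eq0 //.
by rewrite -{2}(gez0_abs ge0) -exprnP tofracXn.
Qed.

(** The Hadamard condition, as an identity between polynomials. *)
Lemma hadamard_shift :
  shiftxy = shiftx U * ('X^b)%:P + shiftx V * shifty%:P.
Proof.
have nzX : 'X != 0 :> Qyx by rewrite polyX_eq0.
have nzY : 'X%:P != 0 :> Qyx by rewrite polyC_eq0 polyX_eq0.
apply/eqP; rewrite -tofrac_eq; apply/eqP.
have shiftxE (U' : {fset int}) : (forall u : U', 0 <= val u + a%:Z) ->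
    FracField.tofrac (shiftx U') = gen_poly varx U' * varx ^+ a.
  move=> ge0; rewrite rmorph_sum /gen_poly big_seq_fsetE mulr_suml.
  by apply: eq_bigr => u _; rewrite /= tofrac_shift //; exact: ge0.
have -> : FracField.tofrac shiftxy = step_poly S * (varx ^+ a * vary ^+ b).
  rewrite rmorph_sum /step_poly big_seq_fsetE mulr_suml.
  apply: eq_bigr => s _; rewrite rmorphM polyC_exp /=.
  rewrite mulrACA; congr (_ * _); rewrite tofrac_shift //.
    exact: S_x.
  exact: S_y.
have shiftyE : FracField.tofrac (shifty%:P) = gen_poly vary T * vary ^+ b.
  rewrite !rmorph_sum /gen_poly big_seq_fsetE mulr_suml; apply: eq_bigr => s _.
  by rewrite /= polyC_exp tofrac_shift //; exact: T_y.
rewrite tofracD !tofracM !shiftxE // shiftyE polyC_exp tofracXn hadamardS.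
by rewrite /vary; ring.
Qed.

(* In terms of Laurent polynomials shifted by x^a y^b, this discards the negative
   powers of x and of y. *)
Let dropxy (p : Qyx) : Qyx := drop_poly a (map_poly (drop_poly b) p).

Let dropxy_sum (I : finType) (P : pred I) (F : I -> Qyx) :
  dropxy (\sum_(i | P i) F i) = \sum_(i | P i) dropxy (F i).
Proof. by rewrite /dropxy raddf_sum drop_poly_sum. Qed.

Let dropxy_monomial i (q : {poly rat}) :
  dropxy ('X^i * q%:P) = drop_poly a 'X^i * (drop_poly b q)%:P.
Proof.
rewrite /dropxy ![_ * _%:P]mulrC !mul_polyC -drop_polyZ; congr drop_poly.
apply/polyP => k; rewrite coef_map_id0 ?drop_poly0r // !coefZ coefXn.
by case: (k == i); rewrite ?mulr1 // !mulr0 drop_poly0r.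
Qed.

Lemma C2S n : coefs (C2 T) n.+1 = drop_poly b (shifty * coefs (C2 T) n).
Proof.
rewrite /= (sum_walksS _ _ _ (fun w : seq T => 'X^`|endpoint stepT w|%N)) mulr_sumr.
rewrite drop_poly_sum; apply: eq_bigr => w /inside_endpoint in_w.
rewrite mulr_suml drop_poly_sum; apply: eq_bigr => s _.
by rewrite -exprD drop_poly_shift // endpoint_rcons.
Qed.

Lemma quadrantS n :
  coefs (quadrant_gf S) n.+1 = dropxy (shiftxy * coefs (quadrant_gf S) n).
Proof.
pose mon (p : int * int) : Qyx := 'X^`|p.1|%N * ('X^`|p.2|%N)%:P.
have gfE k : coefs (quadrant_gf S) k =
    \sum_(w in walks in_N2 step2 k) mon (endpoint step2 w).
  by apply: eq_bigr => w _; rewrite /mon polyC_exp.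
rewrite !gfE (sum_walksS _ _ _ (fun w : seq S => mon (endpoint step2 w))) mulr_sumr.
rewrite dropxy_sum; apply: eq_bigr => w /inside_endpoint/andP[in_x in_y].
rewrite mulr_suml dropxy_sum; apply: eq_bigr => s _.
rewrite mulrACA -exprD -polyCM -exprD dropxy_monomial !drop_poly_shift //.
rewrite endpoint_rcons /mon /in_N2 /=.
case: (0 <= _); last by rewrite mul0r.
case: (0 <= _); first by [].
by rewrite polyC0 mulr0.
Qed.

(** The coefficient of t^n in the Hadamard product at v = 1, each walk with k
    steps in V being paired with the walks of length k with steps in T. *)
Definition paired_walks n : Qyx :=
  \sum_(w in walks in_N uv_step n)
    'X^`|endpoint uv_step w|%N * (coefs (C2 T) (V_steps w))%:P.

(** The two sides satisfy the same recurrence: in a pair of walks, the product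
    with V T extends both walks, and the product with U only the walk in x. *)
Lemma quadrant_paired n : coefs (quadrant_gf S) n = paired_walks n.
Proof.
elim: n => [|n IHn].
  rewrite /= (sum_walks0 _ (fun w : seq S => let p := endpoint step2 w in
    'X ^+ `|p.1|%N * 'X%:P ^+ `|p.2|%N : Qyx)) //.
  rewrite /paired_walks (sum_walks0 _ (fun w : seq (U + V) =>
    'X^`|endpoint uv_step w|%N * (coefs (C2 T) (V_steps w))%:P : Qyx)) //.
  rewrite /endpoint !big_nil /V_steps /= (sum_walks0 _ (fun w : seq T =>
    'X^`|endpoint stepT w|%N : {poly rat})) //.
  by rewrite /endpoint big_nil !expr0.
rewrite quadrantS IHn /paired_walks hadamard_shift.
rewrite (sum_walksS _ _ _ (fun w : seq (U + V) =>
    'X^`|endpoint uv_step w|%N * (coefs (C2 T) (V_steps w))%:P : Qyx)).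
rewrite mulr_sumr dropxy_sum; apply: eq_bigr => w /inside_endpoint in_w.
rewrite big_sumType mulrDl /dropxy raddfD drop_polyD -/(dropxy _) -/(dropxy _).
congr (_ + _).
  rewrite /shiftx !mulr_suml dropxy_sum; apply: eq_bigr => u _.
  rewrite mulrACA -exprD -polyCM dropxy_monomial drop_poly_shift //.
  rewrite endpoint_rcons /V_steps -cats1 count_cat /= !addn0.
  rewrite [X in drop_poly b X]mulrC drop_polyMXn_id.
  by rewrite /in_N; case: (0 <= _); rewrite ?mul0r.
rewrite /shiftx !mulr_suml dropxy_sum; apply: eq_bigr => v _.
rewrite mulrACA -exprD -polyCM dropxy_monomial drop_poly_shift // -C2S.
rewrite endpoint_rcons /V_steps -cats1 count_cat /= addn0 addn1.
by rewrite /in_N; case: (0 <= _); rewrite ?mul0r.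
Qed.
End HadamardModel.

(** The Hadamard product replaces v^k by v^k times the coefficient of index k of
    G, whatever the expression of F as a sum of monomials in v. *)
Lemma eval_hadamard (R : comNzRingType) (F : {fps {poly R}}) (G : {fps R}) n
    (I : finType) (P : pred I) (c : I -> R) (k : I -> nat) :
    coefs F n = \sum_(i | P i) c i *: 'X^(k i) ->
  coefs (eval_v 1 (hadamard_v F G)) n = \sum_(i | P i) c i * coefs G (k i).
Proof.
move=> eF; pose p := coefs F n.
(* Any common bound for the degree of p and for the k i. *)
pose N := (size p + \max_i (k i).+1)%N.
transitivity (\sum_(l < N) p`_l * coefs G l).
  rewrite /= horner_poly; under [LHS]eq_bigr => l _ do rewrite expr1n mulr1.
  rewrite (big_ord_widen N (fun l => p`_l * coefs G l)) ?leq_addr // big_mkcond.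
  apply: eq_bigr => l _; case: ltnP => // le; by rewrite [p`_l]nth_default ?mul0r.
rewrite /p eF; under eq_bigr do rewrite coef_sum mulr_suml.
rewrite exchange_big; apply: eq_bigr => i _ /=.
have lt_k : (k i < N)%N.
  by rewrite /N; apply: leq_trans (leq_addl _ _); exact: (leq_bigmax i).
rewrite (bigD1 (Ordinal lt_k)) //= coefZ coefXn eqxx mulr1 big1 ?addr0 // => l nel.
rewrite coefZ coefXn (_ : _ == _ = false) ?mulr0 ?mul0r //.
by apply: contraNF nel => /eqP e; apply/eqP/val_inj.
Qed.

(** Series in t with coefficients polynomial in u, and series in u, seen as
    series in both variables. *)
Lemma algebraic_lift_mul (B B' A : idomainType) (g : {rmorphism B -> {poly A}})
    (g' : {rmorphism B' -> A}) (F : {fps B}) (F' : {fps B'}) :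
    injective g -> injective g' -> algebraic_series F -> algebraic_series F' ->
  algebraic_elt (@poly_series A)
    (fps_map (@fps_of_poly A) (fps_map g F) * fpsC (fps_map g' F')).
Proof.
move=> injg injg' algF algF'.
pose iota : {rmorphism {poly {poly A}} -> {fps {fps A}}} := @poly_series A.
have algFu : algebraic_elt iota (fps_map (@fps_of_poly A) (fps_map g F)).
  pose h : {rmorphism {fps B} -> {fps {fps A}}} :=
    fps_map (@fps_of_poly A) \o fps_map g.
  pose G : {rmorphism {poly B} -> {poly {poly A}}} := map_poly g.
  pose f : {rmorphism {poly B} -> {fps B}} := @fps_of_poly B.
  have injG : injective G by apply: map_poly_inj_morph.
  have comm p : h (f p) = iota (G p) by rewrite /= fps_map_of_poly.
  exact: (algebraic_elt_morph injG comm algF).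
have algFu' : algebraic_elt iota (fpsC (fps_map g' F')).
  pose h : {rmorphism {fps B'} -> {fps {fps A}}} :=
    (@fps_of_poly _ \o polyC) \o fps_map g'.
  pose G : {rmorphism {poly B'} -> {poly {poly A}}} := polyC \o map_poly g'.
  pose f : {rmorphism {poly B'} -> {fps B'}} := @fps_of_poly B'.
  have injG : injective G.
    by apply: inj_comp; [exact: polyC_inj | apply: map_poly_inj_morph].
  have comm p : h (f p) = iota (G p).
    by rewrite /= fps_map_of_poly /poly_series /= fps_map_of_poly map_polyC.
  exact: (algebraic_elt_morph injG comm algF').
exact: (algebraic_domM (@poly_series_inj A) algFu algFu').
Qed.

(** * Algebraicity of the two factors *)

Section Factors.
Variables (U V T : {fset int}).
Local Notation uv_step := (@union_step U V).

Definition V_weight (s : U + V) : {poly rat} := if s is inr _ then 'X else 1.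
Definition U_weight (s : U + V) : {poly rat} := if s is inl _ then 'X else 1.

(** The walks are counted in a ring of polynomials in x over the weights, whereas
    in C1 the outer variable is the one that marks the steps. *)
Lemma swapXY_walk_monomial (wt : U + V -> {poly rat}) w k :
  \prod_(s <- w) wt s = 'X^k ->
  swapXY (walk_monomial uv_step wt w) =
  ('X^`|endpoint uv_step w|%N)%:P * 'X^k.
Proof.
move=> e; rewrite /walk_monomial e -mul_polyC rmorphM /= swapXY_polyC.
by rewrite map_polyXn rmorphXn /= swapXY_X polyC_exp mulrC.
Qed.

Lemma prod_V_weight (w : seq (U + V)) : \prod_(s <- w) V_weight s = 'X^(V_steps w).
Proof.
elim: w => [|[s|s] w IHw]; rewrite ?big_nil // big_cons IHw /V_steps /=.
  by rewrite mul1r.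
by rewrite -exprS.
Qed.

Lemma prod_U_weight (w : seq (U + V)) :
  \prod_(s <- w) U_weight s = 'X^(size w - V_steps w).
Proof.
elim: w => [|[s|s] w IHw]; rewrite ?big_nil // big_cons IHw /V_steps /=.
  by rewrite -exprS add0n -subSn // count_size.
by rewrite mul1r add1n subSS.
Qed.

Lemma C1_weighted :
  C1 U V = fps_map swapXY (Fps (weighted_walks uv_step V_weight)).
Proof.
apply/fpsP => n; rewrite [RHS]/= rmorph_sum; apply: eq_bigr => w _.
by rewrite /= (swapXY_walk_monomial (prod_V_weight w)) polyC_exp.
Qed.

Lemma swapXY_inj (R : comNzRingType) : injective (@swapXY R).
Proof. exact: (can_inj (@swapXYK R)). Qed.

Lemma C1_algebraic : algebraic_series (C1 U V).
Proof.
rewrite C1_weighted.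
apply: (@algebraic_elt_morph _ _ _ _ (@fps_of_poly {poly {poly rat}})
  (@fps_of_poly {poly {poly rat}}) (map_poly swapXY) (fps_map swapXY)).
- by apply: map_poly_inj_morph; apply: swapXY_inj.
- by move=> p; rewrite /= fps_map_of_poly.
exact: weighted_walks_algebraic.
Qed.

Lemma C2_algebraic : algebraic_series (C2 T).
Proof.
have -> : C2 T = Fps (weighted_walks (fun s : T => val s) (fun=> 1 : rat)).
  apply/fpsP => n; apply: eq_bigr => w _.
  by rewrite /walk_monomial big1 ?scale1r.
exact: weighted_walks_algebraic.
Qed.

(** * The quadrant series as a diagonal *)

Definition lift_xu : {poly {poly rat}} -> {poly Qyx} :=
  map_poly (map_poly polyC) \o swapXY.
HB.instance Definition _ := GRing.RMorphism.on lift_xu.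

(** The series C1, with u marking the steps in U instead of v marking those in
    V, times the series C2 in u: in the coefficient of t^n, a walk with k steps
    in V carries u^{n-k}, so that the diagonal selects the coefficient of index
    k in C2. *)
Definition hadamard_diagonal : {fps {fps Qyx}} :=
  fps_map (@fps_of_poly Qyx)
    (fps_map lift_xu (Fps (weighted_walks uv_step U_weight))) *
  fpsC (C2_xy T).

Lemma hadamard_diagonal_algebraic :
  algebraic_elt (@poly_series Qyx) hadamard_diagonal.
Proof.
apply: algebraic_lift_mul (weighted_walks_algebraic _ _) C2_algebraic; last first.
  exact: polyC_inj.
apply: inj_comp; last exact: swapXY_inj.
by do 2!apply: map_poly_inj_morph; apply: polyC_inj.
Qed.

Lemma diagonal_paired n :
  coefs (diagonal hadamard_diagonal) n = paired_walks U V T n.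
Proof.
rewrite -[LHS]/(coef2 hadamard_diagonal n n) /coef2 /hadamard_diagonal.
rewrite mulrC coefsCM mulrC.
rewrite -[coefs (fps_map _ _) n]/(fps_of_poly (lift_xu (weighted_walks _ _ n))).
rewrite (raddf_sum lift_xu) (raddf_sum (@fps_of_poly Qyx)) mulr_suml coefs_sum.
apply: eq_bigr => w _.
rewrite -[LHS]/(coefs (fps_of_poly (lift_xu (walk_monomial _ _ w)) * C2_xy T) n).
have -> : lift_xu (walk_monomial uv_step U_weight w) =
    'X^`|endpoint uv_step w|%N *: 'X^(n - V_steps w).
  rewrite /lift_xu /= (swapXY_walk_monomial (prod_U_weight w)) size_tuple.
  by rewrite rmorphM /= map_polyC map_polyXn /= map_polyXn mul_polyC.
rewrite coefs_scaled_monoM leq_subr subKn //.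
by rewrite -{2}(size_tuple w) count_size.
Qed.
End Factors.

Theorem proposition21 (S : {fset int * int}) (U V T : {fset int})
    (hadamardS :
       step_poly S = gen_poly varx U + gen_poly varx V * gen_poly vary T) :
  [/\ algebraic_series (C1 U V),
      algebraic_series (C2 T),
      quadrant_gf S = eval_v 1 (hadamard_v (C1_xy U V) (C2_xy T))
    & D_finite (quadrant_gf S)].
Proof.
have [a a_ge] := nonneg_shift (fun s : S + (U + V) =>
  match s with
  | inl s => (val s).1 | inr (inl u) => val u | inr (inr v) => val v
  end).
have [b b_ge] := nonneg_shift (fun s : S + T =>
  match s with inl s => (val s).2 | inr s => val s end).
have paired := quadrant_paired hadamardS
  (fun s => a_ge (inl s)) (fun s => b_ge (inl s))
  (fun u => a_ge (inr (inl u))) (fun v => a_ge (inr (inr v))) (fun s => b_ge (inr s)).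
split; [exact: C1_algebraic | exact: C2_algebraic | |].
  apply/fpsP => n; rewrite paired.
  rewrite (@eval_hadamard _ _ _ _ _ (mem (walks in_N (@union_step U V) n))
    (fun w : n.-tuple (U + V) => 'X^`|endpoint (@union_step U V) w|%N)
    (fun w => V_steps w)) //=.
  rewrite rmorph_sum; apply: eq_bigr => w _.
  by rewrite rmorphM /= map_polyXn -polyC_exp map_polyC /= map_polyXn mul_polyC.
have -> : quadrant_gf S = diagonal (hadamard_diagonal U V T).
  by apply/fpsP => n; rewrite paired diagonal_paired.
have char0 n : n.+1%:R != 0 :> Qyx.
  by rewrite -(rmorph_nat polyC) polyC_eq0 -(rmorph_nat polyC) polyC_eq0 pnatr_eq0.
have [N [p [nzp eq_p]]] :=
  diagonal_differential_equation char0 (hadamard_diagonal_algebraic U V T).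
exact: D_finite_of_equation nzp eq_p.
Qed.
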